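(* Let $\mathbb{K}$ be a field. For every stoss complex $\Delta$ with vertex set $[k]$, the poset $$\mathcal{L}(\Delta) = \{V \subseteq [k] : \Delta|_V \text{ is } \mathbb{K}\text{-acyclic}\}\subseteq \mathfrak{B}(k)$$ is the unique maximal lattice $L\subseteq\mathfrak{B}(k)$ on $k$ atoms whose Scarf complex equals $\Delta$.
   Context: $\mathfrak{B}(k)$ is the lattice of all subsets of $[k]=\{1,\dots,k\}$. Every atomistic lattice on $k$ atoms (labelled by $[k]$) is regarded as a subset $L\subseteq\mathfrak{B}(k)$ closed under intersection and containing $\emptyset$, $[k]$ and all singletons, by sending an element to the set of atoms below it. A $d$-dimensional simplicial complex $\Delta$ with vertex set $[k]$ is a stoss complex if it has a complete $(d-1)$-skeleton (every subset of $[k]$ with at most $d$ elements is a face) and is $\mathbb{K}$-acyclic (all reduced homology over $\mathbb{K}$ vanishes). $\Delta|_V$ is the restriction of $\Delta$ to $V$; by convention $V=\emptyset$ always belongs to $\mathcal{L}(\Delta)$. The Scarf complex of $L\subseteq\mathfrak{B}(k)$ is the set of elements of $L$ that can be written as a join (in $L$) of atoms in a unique way; equivalently, the largest simplicial complex contained in $L$, i.e. $\{\sigma\in L : \tau\in L\text{ for all }\tau\subseteq\sigma\}$. $\operatorname{pdim}_Q L$ denotes the projective dimension of $S/I$ over $S$ for any monomial ideal $I$ in a polynomial ring $S$ over $\mathbb{K}$ whose lcm lattice $L_I$ (least common multiples of subsets of the minimal generators, ordered by divisibility) is isomorphic to $L$; such $I$ exists for every finite atomistic $L$, and the value depends only on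 $L$ and $\mathbb{K}$. A finite atomistic lattice $L$ is maximal if every atomistic lattice $L'\not\cong L$ with the same number of atoms that admits a surjective join-preserving map $L'\to L$ satisfies $\operatorname{pdim}_Q L'>\operatorname{pdim}_Q L$. *)

(* Defs.v *)
From HB Require Import structures.
From mathcomp Require Import all_boot all_order all_algebra.
From mathcomp Require Import boolp.
From mathcomp Require classical_sets.
From mathcomp Require Import mpoly.

Set Implicit Arguments.
Unset Strict Implicit.
Unset Printing Implicit Defensive.

Import GRing.Theory.
Local Open Scope ring_scope.

Definition order_iso (T U : Type) (leT : rel T) (leU : rel U)
    (A : T -> Prop) (B : U -> Prop) : Prop :=
  exists f : T -> U,
    [/\ forall x, A x -> B (f x),
        forall y, B y -> exists x, A x /\ f x = y
      & forall x y, A x -> A y -> leU (f x) (f y) = leT x y].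

(** * Projective dimension *)

Section ProjectiveDimension.
Variable R : nzRingType.

Definition surj (M N : lmodType R) (g : M -> N) : Prop :=
  forall y, exists x, g x = y.

Definition projective (P : lmodType R) : Prop :=
  forall (M N : lmodType R) (g : {linear M -> N}) (f : {linear P -> N}),
    surj g -> exists h : {linear P -> M}, forall x, g (h x) = f x.

(* There is an exact sequence
   0 -> P_p -> ... -> P_1 -> P_0 -> M -> 0 with every P_i projective. *)
Definition has_projres (M : lmodType R) (p : nat) : Prop :=
  exists (P : nat -> lmodType R) (d : forall i, {linear P i.+1 -> P i})
         (e : {linear P 0%N -> M}),
    [/\ forall i, projective (P i) /\ ((p < i)%N -> forall x : P i, x = 0),
        surj e,
        forall x, e x = 0 <-> exists y, d 0%N y = x
      & forall i x, d i x = 0 <-> exists y, d i.+1 y = x].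

Definition is_pdim (M : lmodType R) (p : nat) : Prop :=
  has_projres M p /\ forall q, has_projres M q -> (p <= q)%N.

(* M is (isomorphic to) the quotient module R / I. *)
Definition is_quotient (I : R -> Prop) (M : lmodType R) : Prop :=
  exists pi : {linear R^o -> M}, surj pi /\ forall x, pi x = 0 <-> I x.

End ProjectiveDimension.

(** * Monomial ideals, given by their minimal generators *)

Section MonomialIdeal.
Variables (K : fieldType) (n m : nat) (g : 'I_m -> 'X_{1..n}).

Definition minimal_generators : Prop :=
  forall i j, (g i <= g j)%MM -> i = j.

Definition monomial_ideal (f : {mpoly K[n]}) : Prop :=
  exists c : 'I_m -> {mpoly K[n]}, f = \sum_i c i * 'X_[g i].

(* The lcm of the empty set of generators is the monomial 1. *)
Definition lcm_lattice (u : 'X_{1..n}) : Prop :=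
  exists s : {set 'I_m}, u = \big[@mlcm n/0%MM]_(i in s) g i.

End MonomialIdeal.

(** * Atomistic lattices as subsets of the Boolean lattice *)

(* The vertex (atom) set {1, ..., k} is rendered as 'I_k = {0, ..., k-1}. *)
Section Lattices.
Variable k : nat.
Implicit Types L : {set {set 'I_k}}.

Definition atomistic L : Prop :=
  [/\ set0 \in L, [set: 'I_k] \in L, forall i, [set i] \in L
    & {in L &, forall A B, A :&: B \in L}].

(* The least element of L containing T: this is the join in L of the atoms
   in T, so that the join of A and B in L is [lub L (A :|: B)]. *)
Definition lub L (T : {set 'I_k}) : {set 'I_k} :=
  \bigcap_(V in L | T \subset V) V.

Definition iso L1 L2 : Prop :=
  order_iso (fun A B : {set 'I_k} => A \subset B)
            (fun A B : {set 'I_k} => A \subset B)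
            (fun A => A \in L1) (fun A => A \in L2).

Definition surjective_join_map L1 L2 (f : {set 'I_k} -> {set 'I_k}) : Prop :=
  [/\ {in L1, forall A, f A \in L2},
      {in L2, forall B, exists2 A, A \in L1 & f A = B}
    & {in L1 &, forall A B, f (lub L1 (A :|: B)) = lub L2 (f A :|: f B)}].

Definition scarf L : {set {set 'I_k}} :=
  [set s in L | #|[set T : {set 'I_k} | lub L T == s]| == 1%N].

Section OverField.
Variable K : fieldType.

(* p is the projective dimension of S/I over S = K[x_1, ..., x_n], for some
   n and some monomial ideal I with lcm lattice isomorphic to L. *)
Definition is_pdimQ L (p : nat) : Prop :=
  exists (n m : nat) (g : 'I_m -> 'X_{1..n}) (M : lmodType {mpoly K[n]}),
    [/\ minimal_generators g,
        order_iso (fun u v : 'X_{1..n} => (u <= v)%MM)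
                  (fun A B : {set 'I_k} => A \subset B)
                  (lcm_lattice g) (fun A => A \in L),
        is_quotient (monomial_ideal (K := K) g) M
      & is_pdim M p].

(* For atomistic L, [is_pdimQ L] holds of exactly one p, and xget returns it;
   the default value 0 plays no role. *)
Definition pdimQ L : nat := classical_sets.xget 0%N (is_pdimQ L).

Definition maximal_lattice L : Prop :=
  atomistic L /\
  forall L', atomistic L' -> ~ iso L' L ->
    (exists f, surjective_join_map L' L f) -> (pdimQ L < pdimQ L')%N.

End OverField.
End Lattices.

(** * Stoss complexes *)

Section Complexes.
Variable k : nat.
Implicit Types D : {set {set 'I_k}}.

Definition simplicial_complex D : Prop :=
  [/\ set0 \in D, forall i, [set i] \in D
    & forall s t : {set 'I_k}, t \subset s -> s \in D -> t \in D].

Definition has_dim D (d : nat) : Prop :=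
  (exists2 s : {set 'I_k}, s \in D & #|s| = d.+1) /\
  (forall s : {set 'I_k}, s \in D -> (#|s| <= d.+1)%N).

Definition restriction D (V : {set 'I_k}) : {set {set 'I_k}} :=
  [set s in D | s \subset V].

Section OverField.
Variable K : fieldType.

(* Chains are indexed by cardinality: [is_chain D j c] says that c is a chain
   of dimension j - 1 of the augmented (reduced) chain complex of D. *)
Definition is_chain D (j : nat) (c : {ffun {set 'I_k} -> K}) : Prop :=
  forall s, c s != 0 -> s \in D /\ #|s| = j.

(* The simplicial boundary with respect to the order of 'I_k: the face t of
   v |: t appears with sign (-1)^(position of v in v |: t). *)
Definition boundary (c : {ffun {set 'I_k} -> K}) : {ffun {set 'I_k} -> K} :=
  [ffun t : {set 'I_k} =>
     \sum_(v | v \notin t)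
        (-1) ^+ #|[set w in t | (w < v)%N]| * c (v |: t)].

Definition acyclic D : Prop :=
  forall j z, is_chain D j z -> boundary z = 0 ->
    exists2 c, is_chain D j.+1 c & boundary c = z.

Definition stoss_complex D (d : nat) : Prop :=
  [/\ simplicial_complex D, has_dim D d,
      forall s : {set 'I_k}, (#|s| <= d)%N -> s \in D
    & acyclic D].

(* [restriction D set0] is the complex {set0}, which is not acyclic; set0 is
   included by convention. *)
Definition acyclic_lattice D : {set {set 'I_k}} :=
  [set V : {set 'I_k} | (V == set0) || `[< acyclic (restriction D V) >]].

End OverField.
End Complexes.

(* Main.v *)
(* Write lub for the join of a set of atoms. A monomial ideal with lcm lattice L
   is resolved by its Taylor complex, and tensoring with K leaves the
   label-preserving part of the simplicial boundary, where a face T has label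
   lub T. So pdim L <= p exactly when this part is exact above degree p: a
   shorter resolution yields a homotopy by comparison, and conversely exactness
   splits off the tail of the Taylor complex.

   For Delta itself, all of whose restrictions to elements of L(Delta) are
   acyclic, the cellular complex of Delta is a resolution of length d + 1. If
   L contains Delta and pdim L <= d + 1, then the splitting of the Taylor
   complex projects fillings of (d-1)-cycles inside V in L onto their unique
   fillings in Delta, so L lies in L(Delta). If scarf L = Delta and
   pdim L > d + 1, adjoining a minimal nonface of dimension d to L only changes
   the label-preserving boundary in low degrees, so L is not maximal. *)
From HB Require Import structures.
From mathcomp Require Import all_boot all_order all_algebra.
From mathcomp Require Import boolp.
From mathcomp Require classical_sets.
From mathcomp Require Import mpoly zify.
Require Import Defs.

Set Implicit Arguments.
Unset Strict Implicit.
Unset Printing Implicit Defensive.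

Import GRing.Theory.
Local Open Scope ring_scope.

(** * Projective resolutions *)

(** The resolutions to be compared are arbitrary: neither graded, nor minimal, nor finitely
    generated. The linear algebra is therefore done over K, on matrices indexed by all subsets of
    [k], and carried to the polynomial ring by homogenization, which multiplies entry (i, j) by the
    quotient of the monomial labels of i and j. This is multiplicative on monotone matrices, those
    that never increase labels, and its constant term is the label-preserving part. The obstacle is
    that splitting this part over K is not enough: the splitting has to be corrected by terms that
    lower labels until it splits the whole boundary, and it has to stay monotone.

    Degrees are cardinalities, so a d-dimensional face sits in degree d + 1. A d-face of Delta is a
    Scarf face and forces projective dimension at least d + 1. Since Delta has no face with d + 2
    vertices, its d-cycles vanish and fillings of (d-1)-cycles are unique; this gives both the
    closure of L(Delta) under intersection and the inclusion of every competing lattice in it. *)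

Section Kernel.
Variables (R : nzRingType) (M N : lmodType R) (f : {linear M -> N}).

Definition ker_pred : {pred M} := [pred x | f x == 0].

Fact ker_pred_submod : submod_closed ker_pred.
Proof.
split=> [|a x y]; rewrite !inE ?linear0 // => /eqP fx /eqP fy.
by rewrite linearP fx fy scaler0 addr0.
Qed.

HB.instance Definition _ := GRing.isSubmodClosed.Build R M ker_pred ker_pred_submod.

Record ker := Ker { kval : M; _ : kval \in ker_pred }.
HB.instance Definition _ := [isSub for kval].
HB.instance Definition _ := [Choice of ker by <:].
HB.instance Definition _ := [SubChoice_isSubLmodule of ker by <:].

Lemma kvalP (x : ker) : f (kval x) = 0.
Proof. by case: x => x /=; rewrite inE => /eqP. Qed.

Lemma kval_linear : linear kval.
Proof. by move=> a x y. Qed.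
HB.instance Definition _ := GRing.isLinear.Build R ker M *:%R kval kval_linear.

Section Corestrict.
Variables (A : lmodType R) (g : {linear A -> M}) (gK : forall x, f (g x) = 0).

Definition corestrict (x : A) : ker := Ker (introT eqP (gK x) : g x \in ker_pred).

Lemma corestrict_linear : linear corestrict.
Proof. by move=> a x y; apply: val_inj; rewrite /= linearP. Qed.
HB.instance Definition _ :=
  GRing.isLinear.Build R A ker *:%R corestrict corestrict_linear.
End Corestrict.
End Kernel.

(** Exactness makes [a] a surjection onto the kernel of [b], through which [f] factors; projectivity
    applies to that surjection. *)
Lemma lift_exact (R : nzRingType) (P A B C : lmodType R)
    (a : {linear A -> B}) (b : {linear B -> C}) (f : {linear P -> B}) :
  projective P -> (forall y, b y = 0 <-> exists x, a x = y) ->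
  (forall x, b (f x) = 0) -> exists h : {linear P -> A}, forall x, a (h x) = f x.
Proof.
move=> projP exAB bf0.
have ba0 x : b (a x) = 0 by apply/exAB; exists x.
have surj_a : surj (corestrict ba0).
  move=> y; have /exAB[x ax] := kvalP y.
  by exists x; apply: val_inj; rewrite /= ax.
have [h hP] := projP _ _ _ (corestrict bf0 : {linear P -> ker b}) surj_a.
by exists h => x; have /(congr1 (@kval _ _ _ _)) := hP x.
Qed.

Section Resolution.
Variables (R : nzRingType) (M : lmodType R).

Definition resolution (P : nat -> lmodType R)
    (d : forall i, {linear P i.+1 -> P i}) (e : {linear P 0%N -> M}) : Prop :=
  [/\ forall i, projective (P i), surj e,
      forall x, e x = 0 <-> exists y, d 0%N y = x
    & forall i x, d i x = 0 <-> exists y, d i.+1 y = x].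

Variables (P T : nat -> lmodType R).
Variables (dP : forall i, {linear P i.+1 -> P i}) (eP : {linear P 0%N -> M}).
Variables (dT : forall i, {linear T i.+1 -> T i}) (eT : {linear T 0%N -> M}).
Hypotheses (resP : resolution dP eP) (resT : resolution dT eT).

(* [phi : T -> P] and [psi : P -> T] lift the identity of M and s is a homotopy
   from the identity to [psi \o phi]; only the part in degrees n and n + 1 is
   recorded, which is enough for the induction on n. *)
Lemma comparison n :
  exists (phi : {linear T n -> P n}) (phi' : {linear T n.+1 -> P n.+1})
         (psi : {linear P n -> T n}) (psi' : {linear P n.+1 -> T n.+1})
         (s : {linear T n -> T n.+1}) (s' : {linear T n.+1 -> T n.+2}),
    [/\ forall x, dP n (phi' x) = phi (dT n x),
        forall x, dT n (psi' x) = psi (dP n x)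
      & forall x, psi' (phi' x) - x = dT n.+1 (s' x) + s (dT n x)].
Proof.
have [projP surjP exP0 exP] := resP; have [projT surjT exT0 exT] := resT.
have dP0 x : eP (dP 0%N x) = 0 by apply/exP0; exists x.
have dT0 x : eT (dT 0%N x) = 0 by apply/exT0; exists x.
have dPd i x : dP i (dP i.+1 x) = 0 by apply/exP; exists x.
have dTd i x : dT i (dT i.+1 x) = 0 by apply/exT; exists x.
elim: n => [|n [f [f' [g [g' [s [s' [cf cg hs]]]]]]]].
- have [f fP] := projT 0%N _ _ eP eT surjP.
  have [g gP] := projP 0%N _ _ eT eP surjT.
  have [|f' f'P] := lift_exact (f := f \o dT 0%N) (projT 1%N) exP0.
    by move=> x /=; rewrite fP dT0.
  have [|g' g'P] := lift_exact (f := g \o dP 0%N) (projP 1%N) exT0.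
    by move=> x /=; rewrite gP dP0.
  have [|s sP] := lift_exact (f := (g \o f) \- idfun) (projT 0%N) exT0.
    by move=> x /=; rewrite linearB /= gP fP subrr.
  have [|s' s'P] := lift_exact (f := ((g' \o f') \- idfun) \- (s \o dT 0%N))
      (projT 1%N) (exT 0%N).
    by move=> x /=; rewrite !linearB /= g'P /= f'P /= sP /= subrr.
  by exists f, f', g, g', s, s'; split=> // x; rewrite s'P /= subrK.
- have [|f2 f2P] := lift_exact (f := f' \o dT n.+1) (projT n.+2) (exP n).
    by move=> x /=; rewrite cf dTd linear0.
  have [|g2 g2P] := lift_exact (f := g' \o dP n.+1) (projP n.+2) (exT n).
    by move=> x /=; rewrite cg dPd linear0.
  have [|s2 s2P] := lift_exact (f := ((g2 \o f2) \- idfun) \- (s' \o dT n.+1))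
      (projT n.+2) (exT n.+1).
    move=> x /=; rewrite !linearB /= g2P /= f2P /=.
    by rewrite hs dTd linear0 addr0 subrr.
  by exists f', f2, g', g2, s', s2; split=> // x; rewrite s2P /= subrK.
Qed.

(** In degree [n.+1], which exceeds [q], the composite homotopic to the identity of T factors
    through [P n.+1] = 0. *)
Lemma contract_above_length q n : (forall i, (q < i)%N -> forall x : P i, x = 0) ->
  (q <= n)%N ->
  exists (s : {linear T n -> T n.+1}) (s' : {linear T n.+1 -> T n.+2}),
    forall x, - x = dT n.+1 (s' x) + s (dT n x).
Proof.
move=> P0 qn; have [f [f' [g [g' [s [s' [_ _ hs]]]]]]] := comparison n.
exists s, s' => x; rewrite -hs.
by rewrite (P0 n.+1 _ (f' x)) ?ltnS // linear0 sub0r.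
Qed.
End Resolution.

(** * Direct summands of free modules *)

Section Retract.
Variables (R : nzRingType) (N : nat).

(** For idempotent E this is the image of E. All terms of the resolutions built below are such
    summands of one fixed free module, so a single matrix serves as boundary in every degree. *)
Definition retract (E : 'M[R]_N) : lmodType R :=
  ker ((idfun \- mulmxr E : {linear 'rV[R]_N -> 'rV[R]_N})).

Lemma retractP (E : 'M[R]_N) (x : retract E) : kval x *m E = kval x.
Proof. by have /eqP := kvalP x; rewrite subr_eq0 => /eqP. Qed.

Section Map.
Variables (F : 'M[R]_N) (A : lmodType R) (g : {linear A -> 'rV[R]_N}).
Hypothesis gF : forall x, g x *m F = g x.

Fact to_retract_subproof x :
  (idfun \- mulmxr F : {linear 'rV[R]_N -> 'rV[R]_N}) (g x) = 0.
Proof. by rewrite /= gF subrr. Qed.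

Definition to_retract : {linear A -> retract F} := corestrict to_retract_subproof.

End Map.

Section Projection.
Variables (E : 'M[R]_N) (EE : E *m E = E).

Fact retract_proj_subproof (x : 'rV[R]_N) : mulmxr E x *m E = mulmxr E x.
Proof. by rewrite /= -mulmxA EE. Qed.

Definition retract_proj : {linear 'rV[R]_N -> retract E} :=
  to_retract (g := mulmxr E) retract_proj_subproof.

Lemma retract_projE x : kval (retract_proj x) = x *m E.
Proof. by []. Qed.

Lemma retract_sum_delta (z : retract E) :
  z = \sum_j kval z 0 j *: retract_proj (delta_mx 0 j).
Proof.
transitivity (retract_proj (kval z)).
  by apply: val_inj; rewrite [RHS]retract_projE retractP.
rewrite {1}(row_sum_delta (kval z)) linear_sum.
by apply: eq_bigr => j _; rewrite linearZ.
Qed.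
End Projection.

Lemma retract_projective (E : 'M[R]_N) : E *m E = E -> projective (retract E).
Proof.
move=> EE A B g f surj_g.
pose p := retract_proj EE.
have /(_ _)/cid pre j : exists m, g m = f (p (delta_mx 0 j)) by apply: surj_g.
pose m j := sval (pre j).
have mP j : g (m j) = f (p (delta_mx 0 j)) := svalP (pre j).
pose h (x : retract E) : A := \sum_j kval x 0 j *: m j.
have h_lin : linear h.
  move=> a x y; rewrite /h scaler_sumr -big_split /=.
  by apply: eq_bigr => j _; rewrite !mxE scalerDl scalerA.
pose H := GRing.isLinear.Build R (retract E) A *:%R h h_lin.
pose hl : {linear retract E -> A} := HB.pack h H.
exists hl => x; rewrite [LHS]/= /h linear_sum [in RHS](retract_sum_delta EE x).
by rewrite linear_sum; apply: eq_bigr => j _; rewrite !linearZ /= mP.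
Qed.
End Retract.

(** This replaces tensoring [s] along [phi]: by linearity [s z] is a combination of fixed vectors
    with the coordinates of [z] as coefficients, and these vanish under [phi]. *)
Lemma map_retract_eq0 (R R' : nzRingType) (phi : {rmorphism R -> R'}) (N : nat)
    (E F : 'M[R]_N) (s : {linear retract E -> retract F}) (z : retract E) :
  E *m E = E -> map_mx phi (kval z) = 0 -> map_mx phi (kval (s z)) = 0.
Proof.
move=> EE z0.
have -> : kval (s z) = \sum_j kval z 0 j *: kval (s (retract_proj EE (delta_mx 0 j))).
  rewrite {1}(retract_sum_delta EE z) !linear_sum.
  by apply: eq_bigr => j _; rewrite !linearZ.
apply/rowP=> a; rewrite mxE summxE rmorph_sum [RHS]mxE big1 // => j _.
have /(congr1 (fun u : 'rV_N => u 0 j)) := z0.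
by rewrite !mxE rmorphM /= => ->; rewrite mul0r.
Qed.

(** * Quotient modules *)

Section QuotientModule.
Variables (R : nzRingType) (V : lmodType R) (I : zmodClosed V).
Hypothesis IZ : forall (a : R) x, x \in I -> a *: x \in I.
Local Open Scope quotient_scope.

(** The type carries the proof that I is stable under scaling, so that the module instance can be
    attached to it. *)
Definition quotient_module of (forall (a : R) x, x \in I -> a *: x \in I) : Type :=
  Quotient.quot I.
Local Notation Q := (quotient_module IZ).
HB.instance Definition _ := GRing.Zmodule.on Q.

Definition qpi (x : V) : Q := \pi_(Quotient.quot I) x.

Lemma qpiD x y : qpi (x + y) = qpi x + qpi y.
Proof. exact: Quotient.pi_add. Qed.

Lemma qpi_repr (x : Q) : qpi (repr (x : Quotient.quot I)) = x.
Proof. exact: reprK. Qed.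

Lemma qpi_eq x y : qpi x = qpi y <-> x - y \in I.
Proof. by rewrite Quotient.idealrBE; split=> [eq_xy|/eqP //]; apply/eqP. Qed.

Definition qscale (a : R) (x : Q) : Q := qpi (a *: repr (x : Quotient.quot I)).

Lemma qscale_pi a x : qscale a (qpi x) = qpi (a *: x).
Proof. by apply/qpi_eq; rewrite -scalerBr; apply/IZ/qpi_eq/qpi_repr. Qed.

Fact qscaleA a b x : qscale a (qscale b x) = qscale (a * b) x.
Proof. by rewrite -[x]qpi_repr !qscale_pi scalerA. Qed.
Fact qscale1 : left_id 1 qscale.
Proof. by move=> x; rewrite -[x]qpi_repr qscale_pi scale1r. Qed.
Fact qscaleDr : right_distributive qscale +%R.
Proof.
move=> a x y; rewrite -[x]qpi_repr -[y]qpi_repr -qpiD !qscale_pi.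
by rewrite -qpiD -scalerDr.
Qed.
Fact qscaleDl x : {morph qscale^~ x : a b / a + b}.
Proof. by move=> a b; rewrite -[x]qpi_repr !qscale_pi -qpiD -scalerDl. Qed.
HB.instance Definition _ :=
  GRing.Zmodule_isLmodule.Build R Q qscaleA qscale1 qscaleDr qscaleDl.

Lemma qpi_linear : linear qpi.
Proof. by move=> a x y; rewrite qpiD -qscale_pi. Qed.
HB.instance Definition _ := GRing.isLinear.Build R V Q *:%R qpi qpi_linear.
End QuotientModule.

Lemma quotient_exists (R : nzRingType) (I : R -> Prop) :
  I 0 -> (forall a x y, I x -> I y -> I (a * x + y)) ->
  exists M : lmodType R, is_quotient I M.
Proof.
move=> I0 IP; pose p : {pred R^o} := [pred x | `[< I x >]].
have pZ (a : R) (x : R^o) : x \in p -> a *: x \in p.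
  by move=> /asboolP Ix; apply/asboolP; rewrite -[X in I X]addr0; apply: IP.
have pP : zmod_closed p.
  split=> [|x y /asboolP Ix /asboolP Iy]; first exact/asboolP.
  by apply/asboolP; rewrite addrC -mulN1r; apply: IP.
pose H := GRing.isZmodClosed.Build R^o p pP.
pose J : zmodClosed R^o := HB.pack p H.
exists (quotient_module (pZ : forall a x, x \in J -> a *: x \in J)), (@qpi _ _ J pZ).
split=> [y|x]; first by exists (repr (y : Quotient.quot J)); apply: qpi_repr.
rewrite -(linear0 (@qpi _ _ J pZ)) qpi_eq subr0.
by split=> [/asboolP|Ix] //; apply/asboolP.
Qed.

(** * Labelled chain complexes *)

Section Boundary.
Variables (K : fieldType) (k : nat).
Implicit Types (s t V : {set 'I_k}) (v w : 'I_k) (c z : {ffun {set 'I_k} -> K}).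

Definition sg v t : K := (-1) ^+ #|[set w in t | (w < v)%N]|.

Lemma sg_sqr v t : sg v t * sg v t = 1.
Proof. by rewrite -expr2 sqrr_sign. Qed.

Lemma sg_neq0 v t : sg v t != 0.
Proof. by rewrite signr_eq0. Qed.

Lemma sgU v w t : w \notin t -> sg v (w |: t) = (-1) ^+ (w < v)%N * sg v t.
Proof.
move=> wt; rewrite /sg -exprD; congr (_ ^+ _).
case: ltnP => wv.
  have -> : [set x in w |: t | (x < v)%N] = w |: [set x in t | (x < v)%N].
    by apply/setP=> x; rewrite !inE; case: eqP => // ->; rewrite wv.
  by rewrite cardsU1 !inE (negPf wt).
rewrite add0n; apply: eq_card => x; rewrite !inE.
by case: eqP => //= ->; rewrite ltnNge wv andbF.
Qed.

Lemma sg_cross v w t : v != w -> v \notin t -> w \notin t ->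
  sg v (w |: t) * sg w (v |: t) = - (sg w t * sg v t).
Proof.
move=> vw vt wt; rewrite !sgU // mulrACA [sg v t * _]mulrC.
case: (ltngtP v w) vw => [_ _|_ _|/val_inj->]; last by rewrite eqxx.
  by rewrite expr0 expr1 mul1r mulN1r.
by rewrite expr0 expr1 mulr1 mulN1r.
Qed.

Lemma sg_swap v w t : v != w -> v \notin t -> w \notin t ->
  sg w t * sg v (w |: t) = - (sg v t * sg w (v |: t)).
Proof.
move=> vw vt wt; have := sg_cross vw vt wt.
move=> /(congr1 (fun x => sg w t * (x * sg w (v |: t)))).
rewrite -[_ * sg w (v |: t)]mulrA sg_sqr mulr1 => ->.
by rewrite !mulNr mulrN !mulrA sg_sqr mul1r.
Qed.

Lemma boundaryE c t : boundary c t = \sum_(v | v \notin t) sg v t * c (v |: t).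
Proof. by rewrite ffunE. Qed.

Lemma boundary_boundary c : boundary (boundary c) = 0.
Proof.
apply/ffunP=> t; rewrite boundaryE [RHS]ffunE.
(* The double sum runs over ordered pairs of distinct vertices outside t; (v, w) and (w, v)
   contribute opposite terms. *)
pose F (p : 'I_k * 'I_k) := sg p.1 t * sg p.2 (p.1 |: t) * c (p.2 |: (p.1 |: t)).
pose P (p : 'I_k * 'I_k) := [&& p.1 \notin t, p.2 \notin t & p.1 != p.2].
transitivity (\sum_(p | P p) F p).
  rewrite (eq_bigl (fun p => (p.1 \notin t) && (p.2 \notin p.1 |: t))); last first.
    by move=> p; rewrite /P !inE negb_or [p.2 == _]eq_sym [(_ != _) && _]andbC.
  rewrite -(pair_big_dep (fun v => v \notin t) (fun v w => w \notin v |: t)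
    (fun v w => F (v, w))) /=.
  apply: eq_bigr => v _; rewrite boundaryE mulr_sumr.
  by apply: eq_bigr => w _; rewrite /F mulrA.
rewrite (bigID (fun p : 'I_k * 'I_k => (p.1 < p.2)%N)) /=.
have swapK : involutive (fun p : 'I_k * 'I_k => (p.2, p.1)) by case.
rewrite [X in _ + X](reindex_inj (inv_inj swapK)) /=.
rewrite [X in _ + X](eq_bigl (fun p => P p && (p.1 < p.2)%N)); last first.
  move=> [v w]; rewrite /P /= [w == v]eq_sym andbCA -!andbA.
  case: (v \notin t) (w \notin t) => [] [] //=.
  by rewrite -leqNgt leq_eqVlt -val_eqE /=; case: eqP.
rewrite -big_split big1 // => -[v w] /andP[/and3P[/= vt wt vw] _].
by rewrite /F /= sg_swap 1?eq_sym // setUCA mulNr addNr.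
Qed.

(** The join with the vertex a; faces already containing a are sent to 0. It is the contracting
    homotopy of a simplex that has a as a vertex. *)
Definition cone (a : 'I_k) c : {ffun {set 'I_k} -> K} :=
  [ffun t : {set 'I_k} => if a \in t then sg a (t :\ a) * c (t :\ a) else 0].

Lemma boundary_cone a c : boundary (cone a c) = c - cone a (boundary c).
Proof.
apply/ffunP=> t; rewrite !ffunE -!boundaryE; case: ifPn => [at_|at_]; last first.
  rewrite subr0 boundaryE (bigD1 a) //= big1 => [|v /andP[vt va]]; last first.
    by rewrite ffunE !inE eq_sym (negPf va) (negPf at_) mulr0.
  by rewrite addr0 ffunE setU11 setU1K // mulrA sg_sqr mul1r.
rewrite [boundary c _]boundaryE (bigD1 a) ?setD11 //= setD1K // mulrDr mulrA.
rewrite sg_sqr mul1r opprD addNKr boundaryE mulr_sumr -sumrN.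
apply: eq_big => [v|v vt]; first by rewrite !inE; case: eqP => [->|]; rewrite ?at_ ?andbT.
have va : v != a by apply: contraNneq vt => ->.
have vD : v \notin t :\ a by rewrite !inE negb_and vt orbT.
have tE : (v |: t) :\ a = v |: (t :\ a).
  by apply/setP=> x; rewrite !inE; case: (x =P v) => // ->; rewrite va.
rewrite ffunE !inE at_ orbT tE !mulrA -mulNr; congr (_ * _).
by rewrite -[in sg v t](setD1K at_) sg_cross ?setD11.
Qed.

End Boundary.

(** * Splitting a label-filtered boundary *)

Section LabelledComplex.
Variables (K : fieldType) (N k : nat).
Variables (deg : 'I_N -> nat) (lab : 'I_N -> {set 'I_k}).
Implicit Types (A B : 'M[K]_N) (x : 'rV[K]_N).

(* Row vectors are chains and matrices act on the right. *)
Definition monotone A : Prop := forall i j, A i j != 0 -> lab j \subset lab i.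

(** A degree shift by b - a, written additively to stay in [nat]: boundaries have (a, b) = (1, 0),
    homotopies (0, 1). *)
Definition homogeneous (a b : nat) A : Prop :=
  forall i j, A i j != 0 -> (deg j + a = deg i + b)%N.

Definition supported (p : pred nat) x : Prop := forall i, x 0 i != 0 -> p (deg i).

Definition label_part A : 'M[K]_N :=
  \matrix_(i, j) if lab i == lab j then A i j else 0.

Definition exact_above p A : Prop :=
  forall x, supported (fun n => p < n)%N x -> x *m label_part A = 0 ->
    (x <= label_part A)%MS.

Lemma mulmx_neq0 (m n q : nat) (A : 'M[K]_(m, n)) (B : 'M[K]_(n, q)) i j :
  (A *m B) i j != 0 -> exists l, A i l != 0 /\ B l j != 0.
Proof.
rewrite mxE => AB; have [l] : exists l, A i l * B l j != 0.
  apply/existsP; apply: contraNT AB => /existsPn AB.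
  by rewrite big1 // => l _; apply/eqP/negbNE/AB.
by rewrite mulf_eq0 negb_or => /andP[]; exists l.
Qed.

Lemma addmx_neq0 (m n : nat) (A B : 'M[K]_(m, n)) i j :
  (A + B) i j != 0 -> A i j != 0 \/ B i j != 0.
Proof.
by rewrite mxE; case: (eqVneq (A i j) 0) => [->|]; [rewrite add0r; right | left].
Qed.

Lemma monotone1 : monotone 1.
Proof. by move=> i j; rewrite mxE; case: (i =P j) => [->|]; rewrite ?eqxx. Qed.

Lemma monotoneN A : monotone A -> monotone (- A).
Proof. by move=> mA i j; rewrite mxE oppr_eq0; apply: mA. Qed.

Lemma monotoneD A B : monotone A -> monotone B -> monotone (A + B).
Proof. by move=> mA mB i j /addmx_neq0[/mA|/mB]. Qed.

Lemma monotoneM A B : monotone A -> monotone B -> monotone (A *m B).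
Proof. by move=> mA mB i j /mulmx_neq0[l [/mA il /mB]] /subset_trans; apply. Qed.

Lemma homogeneous1 : homogeneous 0 0 1.
Proof. by move=> i j; rewrite mxE; case: (i =P j) => [->|]; rewrite ?eqxx. Qed.

Lemma homogeneousN a b A : homogeneous a b A -> homogeneous a b (- A).
Proof. by move=> hA i j; rewrite mxE oppr_eq0; apply: hA. Qed.

Lemma homogeneousD a b A B :
  homogeneous a b A -> homogeneous a b B -> homogeneous a b (A + B).
Proof. by move=> hA hB i j /addmx_neq0[/hA|/hB]. Qed.

Lemma homogeneousM a b c e A B :
  homogeneous a b A -> homogeneous c e B -> homogeneous (a + c) (b + e) (A *m B).
Proof.
move=> hA hB i j /mulmx_neq0[l [/hA il /hB lj]].
lia.
Qed.

Lemma monotone_sum (I : Type) (r : seq I) (F : I -> 'M[K]_N) :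
  (forall i, monotone (F i)) -> monotone (\sum_(i <- r) F i).
Proof.
move=> mF; elim/big_ind: _ => // [i j|A B]; last exact: monotoneD.
by rewrite mxE eqxx.
Qed.

Lemma homogeneous_sum a b (I : Type) (r : seq I) (F : I -> 'M[K]_N) :
  (forall i, homogeneous a b (F i)) -> homogeneous a b (\sum_(i <- r) F i).
Proof.
move=> mF; elim/big_ind: _ => // [i j|A B]; last exact: homogeneousD.
by rewrite mxE eqxx.
Qed.

Lemma monotoneX A n : monotone A -> monotone (A ^+ n).
Proof.
move=> mA; elim: n => [|n IH]; first exact: monotone1.
by rewrite exprS; apply: monotoneM.
Qed.

Lemma homogeneousX A n : homogeneous 0 0 A -> homogeneous 0 0 (A ^+ n).
Proof.
move=> mA; elim: n => [|n IH]; first exact: homogeneous1.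
by rewrite exprS; apply: (homogeneousM mA IH).
Qed.

Lemma label_part_neq0 A i j :
  label_part A i j != 0 -> lab i = lab j /\ A i j != 0.
Proof. by rewrite mxE; case: (lab i =P lab j) => // _; rewrite eqxx. Qed.

(** Contractions are obtained one degree at a time. As B is homogeneous and respects the grading,
    each graded component of a cycle is again a cycle. *)
Lemma exact_above_graded p B : homogeneous 1 0 B ->
  (forall i, (p < i)%N -> forall x, supported (pred1 i) x ->
     x *m label_part B = 0 -> (x <= label_part B)%MS) -> exact_above p B.
Proof.
move=> hB exB x xp x0.
pose part i : 'rV[K]_N := \row_a if deg a == i then x 0 a else 0.
have -> : x = \sum_(i < (\max_a deg a).+1) part i.
  apply/rowP=> a; rewrite summxE.
  have da : (deg a < (\max_a deg a).+1)%N by rewrite ltnS leq_bigmax.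
  rewrite (bigD1 (Ordinal da)) //= mxE eqxx big1 ?addr0 // => i ia.
  by rewrite mxE ifN //; apply: contraNneq ia => ai; apply/eqP/val_inj.
apply: summx_sub => i _; have [ip|pi] := leqP i p.
  rewrite (_ : part i = 0) ?sub0mx //; apply/rowP=> a; rewrite !mxE.
  case: eqP => // ai; apply/eqP/negbNE/negP => /xp.
  by rewrite ai ltnNge ip.
apply: (exB _ pi) => [a|]; first by rewrite mxE; case: ifP; rewrite ?eqxx.
apply/rowP=> b; rewrite [RHS]mxE.
have [ib|ib] := eqVneq (i : nat) (deg b).+1.
  transitivity ((x *m label_part B) 0 b); last by rewrite x0 mxE.
  rewrite mxE [RHS]mxE; apply: eq_bigr => a _.
  have [->|/label_part_neq0[_ /hB ab]] := eqVneq (label_part B a b) 0.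
    by rewrite !mulr0.
  by rewrite mxE ifT //; apply/eqP; lia.
apply/eqP/negbNE/negP => /mulmx_neq0[a [+ /label_part_neq0[_ /hB ab]]].
by rewrite mxE; case: (deg a =P i) => [ai _|]; rewrite ?eqxx //; case/eqP: ib; lia.
Qed.

Lemma label_part_pinv B : homogeneous 1 0 B ->
  exists G, [/\ homogeneous 0 1 G, forall i j, G i j != 0 -> lab i = lab j
    & label_part B *m G *m label_part B = label_part B].
Proof.
move=> hB; set B0 := label_part B.
have B0P i j : B0 i j != 0 -> lab i = lab j /\ deg i = (deg j).+1.
  by move=> /label_part_neq0[-> /hB ij]; split=> //; lia.
pose G : 'M[K]_N :=
  \matrix_(i, j) if (deg j == (deg i).+1) && (lab i == lab j) then pinvmx B0 i j else 0.
exists G; split=> [i j|i j|].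
- by rewrite mxE; case: ifP => [/andP[/eqP-> _] _|]; rewrite ?eqxx //; lia.
- by rewrite mxE; case: ifP => [/andP[_ /eqP]|]; rewrite ?eqxx.
rewrite -[RHS](mulmxKpV (submx_refl B0)); apply/matrixP=> a b.
have [/andP[/eqP dab /eqP lab_ab]|nab] :=
  boolP ((deg a == (deg b).+1) && (lab a == lab b)).
  rewrite mxE [RHS]mxE; apply: eq_bigr => j _.
  have [->|/B0P[lj dj]] := eqVneq (B0 j b) 0; first by rewrite !mulr0.
  congr (_ * _); rewrite mxE [RHS]mxE; apply: eq_bigr => i _.
  have [->|/B0P[li di]] := eqVneq (B0 a i) 0; first by rewrite !mul0r.
  by congr (_ * _); rewrite mxE dj -dab di -li lab_ab lj !eqxx.
rewrite [RHS](_ : _ = 0).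
  apply/eqP/negbNE/negP => /mulmx_neq0[j [/mulmx_neq0[i [/B0P[li di] Gij]]]].
  move=> /B0P[lj dj]; move: Gij; rewrite mxE; case: ifP; rewrite ?eqxx //.
  case/andP=> /eqP dij /eqP lij _; case/negP: nab.
  by rewrite li lij lj eqxx andbT; lia.
rewrite (mulmxKpV (submx_refl B0)).
by apply/eqP/negbNE/negP => /B0P[lE dE]; case/negP: nab; rewrite lE dE !eqxx.
Qed.

(* The splitting h0 contracts the label-preserving part of B above degree p, so
   D = B h0 + h0 B commutes with B and 1 - D strictly lowers labels there; being
   nilpotent, it can be inverted by a finite geometric series. *)
Lemma filtered_section p B :
  monotone B -> homogeneous 1 0 B -> B *m B = 0 -> exact_above p B ->
  exists H, [/\ monotone H, homogeneous 0 1 H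
    & forall x, supported (fun n => p < n)%N x -> x *m B *m H *m B = x *m B].
Proof.
move=> mB hB BB exB; have [G [hG lG B0G]] := label_part_pinv hB.
set B0 := label_part B in B0G.
have mB0 : monotone B0 by move=> i j /label_part_neq0[->].
have hB0 : homogeneous 1 0 B0 by move=> i j /label_part_neq0[_ /hB].
have mG : monotone G by move=> i j /lG->.
have B0B0 : B0 *m B0 = 0.
  apply/matrixP=> a b; rewrite [RHS]mxE.
  have [lab_ab|nab] := eqVneq (lab a) (lab b).
    transitivity ((B *m B) a b); last by rewrite BB mxE.
    rewrite mxE [RHS]mxE.
    apply: eq_bigr => i _; rewrite !mxE.
    have [->|Bai] := eqVneq (B a i) 0; first by rewrite if_same !mul0r.
    have [->|Bib] := eqVneq (B i b) 0; first by rewrite if_same !mulr0.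
    have -> : lab i = lab a; last by rewrite lab_ab !eqxx.
    by apply/eqP; rewrite eqEsubset (mB _ _ Bai) lab_ab (mB _ _ Bib).
  apply/eqP/negbNE/negP => /mulmx_neq0[l [/label_part_neq0[al _]]].
  by move=> /label_part_neq0[lb _]; rewrite al lb eqxx in nab.
(* G alone contracts only cycles. For general x the remainder y = x - x B0 G is a cycle, so x = x B0
   G + y G B0; expanding y gives this correction of G. *)
pose h0 := G - G * G * B0.
have hh0 : homogeneous 0 1 h0.
  apply: homogeneousD => //; apply: homogeneousN => i j.
  by move=> /(homogeneousM (homogeneousM hG hG) hB0); lia.
have lh0 i j : h0 i j != 0 -> lab i = lab j.
  move=> /addmx_neq0[/lG //|]; rewrite mxE oppr_eq0.
  by move=> /mulmx_neq0[l [/mulmx_neq0[m [/lG-> /lG->]] /label_part_neq0[->]]].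
have mh0 : monotone h0 by move=> i j /lh0->.
have contr x : supported (fun n => (p < n)%N) x -> x *m (B0 * h0 + h0 * B0) = x.
  move=> xp; set y := x - x *m B0 *m G.
  have yB0 : y *m B0 = 0 by rewrite mulmxBl -!mulmxA [B0 *m _]mulmxA B0G subrr.
  have yp : supported (fun n => (p < n)%N) y.
    move=> i /addmx_neq0[/xp //|]; rewrite mxE oppr_eq0.
    by move=> /mulmx_neq0[l [/mulmx_neq0[m [/xp pm /hB0 e]] /hG e']]; lia.
  have /submxP[z yE] := exB y yp yB0.
  have yGB0 : y *m G *m B0 = y by rewrite yE -!mulmxA [B0 *m _]mulmxA B0G.
  transitivity (x *m B0 *m G + y *m G *m B0); last by rewrite yGB0 addrC subrK.
  have -> : B0 * h0 + h0 * B0 = B0 *m G + (G *m B0 - B0 *m G *m G *m B0).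
    rewrite /h0 mulrBl mulrBr -(mulrA (G * G)) -[B0 * B0]/(B0 *m B0) B0B0.
    by rewrite mulr0 subr0 !mulrA -addrA [- _ + _]addrC.
  by rewrite mulmxDr mulmxBr /y !mulmxBl !mulmxA.
clearbody h0; pose D := B * h0 + h0 * B; pose Q := 1 - D.
have QP i j : (p < deg i)%N -> Q i j != 0 ->
    lab j \proper lab i /\ deg j = deg i.
  move=> pi; set A := h0 * (B - B0) + (B - B0) * h0.
  have -> : Q i j = - A i j.
    have /contr : supported (fun n => (p < n)%N) (delta_mx 0 i).
      by move=> l; rewrite mxE eqxx; case: (l =P i) => [->|]; rewrite ?eqxx.
    move=> /(congr1 (fun u : 'rV_N => u 0 j)); rewrite -rowE mxE => eD0.
    have -> : A = D - (B0 * h0 + h0 * B0).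
      by rewrite /A /D mulrBr mulrBl opprD [RHS]addrACA addrC.
    have sub (X Y : 'M[K]_N) : (X - Y) i j = X i j - Y i j by rewrite !mxE.
    rewrite /Q !sub eD0 opprB; congr (_ - _).
    by rewrite !mxE eqxx [j == i]eq_sym.
  rewrite oppr_eq0 => Aij.
  have BB0 a b : (B - B0) a b != 0 -> lab b \proper lab a /\ (deg b + 1 = deg a)%N.
    rewrite !mxE; case: (lab a =P lab b) => [_|ne]; rewrite ?subrr ?eqxx // subr0 => Bab.
    by rewrite properEneq mB // andbT eq_sym (introN eqP ne) (hB _ _ Bab) addn0.
  move: Aij => /addmx_neq0[] /mulmx_neq0[l []].
    by move=> il /BB0[lj dj]; rewrite (lh0 _ _ il); split=> //; have := hh0 _ _ il; lia.
  by move=> /BB0[li di] lj; rewrite -(lh0 _ _ lj); split=> //; have := hh0 _ _ lj; lia.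
have QX r i j : (p < deg i)%N -> (Q ^+ r) i j != 0 -> (#|lab j| + r <= #|lab i|)%N.
  elim: r i => [|r IH] i pi.
    by rewrite addn0 mxE; case: (i =P j) => [->|]; rewrite ?eqxx.
  rewrite exprS => /mulmx_neq0[l [/QP-/(_ pi)[/proper_card li di]]].
  by move=> /IH; rewrite di => /(_ pi); lia.
have BD : B * D = B * h0 * B.
  by rewrite mulrDr !mulrA -[B * B]/(B *m B) BB mul0r add0r.
have DB : D * B = B * h0 * B.
  by rewrite mulrDl -!mulrA -[B * B]/(B *m B) BB !mulr0 addr0.
(* A nonzero entry of Q^r above degree p costs the label at least r of its at most k atoms, so
   Q^(k+1) vanishes there and F inverts D. Since B h0 B = D B and F commutes with B, the product F
   h0 is the desired section. *)
pose F := \sum_(i < k.+1) Q ^+ i.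
have comF A : A * D = D * A -> A * F = F * A.
  move=> AD; apply: commr_sum => i _; apply: commrX.
  by rewrite /GRing.comm mulrBr mulrBl mulr1 mul1r AD.
have DF : D * F = 1 - Q ^+ k.+1.
  by rewrite -opprB subrX1 -mulNr opprB opprB addrC subrK.
exists (F * h0).
have mQ : monotone Q.
  apply: monotoneD; [exact: monotone1 | apply: monotoneN].
  by apply: monotoneD; apply: monotoneM.
have hQ : homogeneous 0 0 Q.
  apply: homogeneousD; [exact: homogeneous1 | apply: homogeneousN].
  by apply: homogeneousD => i j; [move/(homogeneousM hB hh0)|move/(homogeneousM hh0 hB)]; lia.
split.
- by apply: monotoneM => //; apply: monotone_sum => i; apply: monotoneX.
- have hF : homogeneous 0 0 F by apply: homogeneous_sum => i; apply: homogeneousX.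
  exact: (homogeneousM hF hh0).
move=> x xp; transitivity (x *m (B * (F * h0) * B)).
  by rewrite -!mulmxE !mulmxA.
have -> : B * (F * h0) * B = (1 - Q ^+ k.+1) * B.
  by rewrite -DF mulrA (comF D) // (comF B) ?BD ?DB // -!mulrA DB !mulrA.
rewrite mulrBl mul1r mulmxBr -[RHS]subr0; congr (_ - _).
rewrite -mulmxE mulmxA (_ : x *m Q ^+ k.+1 = 0) ?mul0mx //.
apply/matrixP=> i j; rewrite [RHS]mxE; apply/eqP/negbNE/negP.
move=> /mulmx_neq0[l [+ Ql]]; rewrite ord1 => /xp/QX-/(_ _ _ Ql).
by have := subset_leq_card (subsetT (lab l)); rewrite cardsT card_ord; lia.
Qed.
End LabelledComplex.

(** * Homogenization and multigraded strands *)

Section Homogenize.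
Variables (K : fieldType) (N k n : nat) (lab : 'I_N -> {set 'I_k}).
Variable lm : 'I_N -> 'X_{1..n}.
Hypothesis lmP : forall i j, (lm j <= lm i)%MM = (lab j \subset lab i).
Implicit Types (A B : 'M[K]_N) (x y : 'rV[{mpoly K[n]}]_N) (c : 'rV[K]_N).
Implicit Type w : 'X_{1..n}.

(* On monotone matrices the truncated subtraction is exact. *)
Definition homogenize A : 'M[{mpoly K[n]}]_N :=
  \matrix_(i, j) (A i j *: 'X_[lm i - lm j]).

Lemma homogenizeM A B : monotone lab A -> monotone lab B ->
  homogenize (A *m B) = homogenize A *m homogenize B.
Proof.
move=> mA mB; apply/matrixP=> i j; rewrite !mxE scaler_suml.
apply: eq_bigr => l _; rewrite !mxE.
have [->|/mA il] := eqVneq (A i l) 0; first by rewrite mul0r !scale0r mul0r.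
have [->|/mB lj] := eqVneq (B l j) 0; first by rewrite mulr0 !scale0r mulr0.
rewrite -scalerAl -scalerAr scalerA -mpolyXD; congr (_ *: 'X_[_]).
by rewrite addmBA ?submK ?lmP.
Qed.

Lemma homogenize0 : homogenize 0 = 0.
Proof. by apply/matrixP=> i j; rewrite !mxE scale0r. Qed.

(** Reduction modulo the variables: the quotient of two monomial labels has a constant term only
    when the labels agree. *)
Lemma homogenize_label_part A : monotone lab A ->
  map_mx (mcoeff 0%MM) (homogenize A) = label_part lab A.
Proof.
move=> mA; apply/matrixP=> i j; rewrite !mxE mcoeffZ mcoeffX.
have [->|/mA ji] := eqVneq (A i j) 0; first by rewrite mul0r if_same.
have -> : (lm i - lm j == 0)%MM = (lm i <= lm j)%MM.
  apply/eqP/mnm_lepP => [/mnmP e l|le].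
    by have := e l; rewrite mnmBE mnm0E => /eqP; rewrite subn_eq0.
  by apply/mnmP=> l; rewrite mnmBE mnm0E; apply/eqP; rewrite subn_eq0.
by rewrite lmP eqEsubset ji andbT; case: ifP; rewrite ?mulr1 ?mulr0.
Qed.

(* 'rV[{mpoly K[n]}]_N is graded with its i-th basis vector in degree [lm i]. *)
Definition strand w x : 'rV[K]_N :=
  \row_j if (lm j <= w)%MM then (x 0 j)@_(w - lm j) else 0.

Definition unstrand w c : 'rV[{mpoly K[n]}]_N := \row_j (c 0 j *: 'X_[w - lm j]).

Lemma strand_neq0 w x j : strand w x 0 j != 0 -> (lm j <= w)%MM /\ x 0 j != 0.
Proof.
rewrite mxE; case: ifP => [_|]; rewrite ?eqxx // => xj; split=> //.
by apply: contraNneq xj => ->; rewrite mcoeff0.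
Qed.

Lemma strand0 w : strand w 0 = 0.
Proof. by apply/rowP=> j; rewrite !mxE mcoeff0 if_same. Qed.

Lemma mcoeffMX_sub (p : {mpoly K[n]}) m u :
  (p * 'X_[m])@_u = if (m <= u)%MM then p@_(u - m) else 0.
Proof.
case: ifPn => [mu|mu]; first by rewrite -{1}(submK mu) addmC mcoeffMX.
apply: memN_msupp_eq0; rewrite (perm_mem (msuppMX p m)).
by apply: contraNN mu => /mapP[m' _ ->]; apply: lem_addr.
Qed.

Lemma strandM w x A : monotone lab A ->
  strand w (x *m homogenize A) = strand w x *m A.
Proof.
move=> mA; apply/rowP=> j; rewrite [LHS]mxE [RHS]mxE.
case: ifPn => [jw|jw]; last first.
  rewrite big1 // => i _; have [->|/mA ij] := eqVneq (A i j) 0; first by rewrite mulr0.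
  rewrite mxE ifN ?mul0r //; apply: contraNN jw; apply: lepm_trans.
  by rewrite lmP.
rewrite mxE raddf_sum /=; apply: eq_bigr => i _; rewrite !mxE.
have [->|/mA ij] := eqVneq (A i j) 0.
  by rewrite scale0r !mulr0 mcoeff0.
rewrite -scalerAr mcoeffZ mulrC mcoeffMX_sub; congr (_ * _).
have ->: (lm i - lm j <= w - lm j)%MM = (lm i <= w)%MM.
  apply/mnm_lepP/mnm_lepP => le l; have := le l; rewrite !mnmBE.
    by have := mnm_lepP jw l; lia.
  by lia.
case: ifP => // _; congr (_@_ _); apply/mnmP=> l; rewrite !mnmBE.
have /mnm_lepP/(_ l) : (lm j <= lm i)%MM by rewrite lmP.
by have := mnm_lepP jw l; lia.
Qed.

(** The condition on the support of c makes every [w - lm j] that occurs a true difference. *)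
Lemma unstrandM w c A : monotone lab A ->
  (forall j, c 0 j != 0 -> (lm j <= w)%MM) ->
  unstrand w c *m homogenize A = unstrand w (c *m A).
Proof.
move=> mA cw; apply/rowP=> j; rewrite !mxE scaler_suml.
apply: eq_bigr => i _; rewrite !mxE.
have [->|/cw iw] := eqVneq (c 0 i) 0; first by rewrite mul0r !scale0r mul0r.
have [->|/mA ij] := eqVneq (A i j) 0; first by rewrite mulr0 !scale0r mulr0.
rewrite -scalerAl -scalerAr scalerA -mpolyXD; congr (_ *: 'X_[_]).
by rewrite addmBA ?submK ?lmP.
Qed.

Lemma strand_decomposition x : exists W : seq 'X_{1..n},
  x = \sum_(w <- W) unstrand w (strand w x).
Proof.
pose W := undup (flatten [seq [seq (lm j + m)%MM | m <- msupp (x 0 j)] | j <- enum 'I_N]).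
exists W; apply/rowP=> j; rewrite summxE; apply/mpolyP=> m; rewrite raddf_sum /=.
have coef w : (unstrand w (strand w x) 0 j)@_m =
    if w == (lm j + m)%MM then (x 0 j)@_m else 0.
  rewrite mxE mcoeffZ mcoeffX mxE; case: (w =P _) => [->|ne].
    by rewrite lem_addr addmC addmK eqxx mulr1.
  case: ifP => [jw|_]; last by rewrite mul0r.
  rewrite (introF eqP) ?mulr0 // => e; case: ne.
  by rewrite -e addmC submK.
rewrite (eq_bigr _ (fun w _ => coef w)) /=.
have [jW|jW] := boolP ((lm j + m)%MM \in W).
  rewrite (bigD1_seq (lm j + m)%MM) ?undup_uniq //= eqxx.
  by rewrite big1 ?addr0 // => w /negPf->.
rewrite big_seq big1 => [|w wW]; last by rewrite ifN //; apply: contraNneq jW => <-.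
apply: memN_msupp_eq0; apply: contraNN jW => mx; rewrite mem_undup.
apply/flatten_mapP; exists j; first by rewrite mem_enum.
by apply/mapP; exists m.
Qed.

End Homogenize.

(** * The boundary matrix of the full simplex *)

Section BoundaryMatrix.
Variables (K : fieldType) (k : nat).
Local Notation N := #|{: {set 'I_k}}|.
Implicit Types (D : {set {set 'I_k}}) (s t V : {set 'I_k}).

Definition face (i : 'I_N) : {set 'I_k} := enum_val i.
Definition card_face (i : 'I_N) : nat := #|face i|.

Lemma enum_rank_face i : enum_rank (face i) = i. Proof. exact: enum_valK. Qed.
Lemma face_rank s : face (enum_rank s) = s. Proof. exact: enum_rankK. Qed.

(** At most one v contributes to the sum, the vertex by which face i exceeds its facet face j; the
    sum avoids having to choose it. *)
Definition boundary_mx : 'M[K]_N :=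
  \matrix_(i, j) \sum_(v | (v \notin face j) && (v |: face j == face i)) sg K v (face j).
Local Notation bd := boundary_mx.

Definition row_of (c : {ffun {set 'I_k} -> K}) : 'rV[K]_N := \row_i c (face i).
Definition of_row (x : 'rV[K]_N) : {ffun {set 'I_k} -> K} :=
  [ffun s => x 0 (enum_rank s)].

Lemma row_ofK : cancel row_of of_row.
Proof. by move=> c; apply/ffunP=> s; rewrite !ffunE mxE face_rank. Qed.

Lemma of_rowK : cancel of_row row_of.
Proof. by move=> x; apply/rowP=> i; rewrite mxE ffunE enum_rank_face. Qed.

Lemma row_of_boundary c : row_of (boundary c) = row_of c *m bd.
Proof.
apply/rowP=> j; rewrite [RHS]mxE mxE boundaryE.
under [RHS]eq_bigr do rewrite !mxE big_mkcondr mulr_sumr.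
rewrite exchange_big; apply: eq_bigr => v vj /=.
rewrite (bigD1 (enum_rank (v |: face j))) //= face_rank eqxx mulrC.
rewrite big1 ?addr0 // => i ne; rewrite ifN ?mulr0 //.
by apply: contraNneq ne => ->; rewrite enum_rank_face.
Qed.

Lemma boundary_mx_sqr : bd *m bd = 0.
Proof.
apply/row_matrixP=> i; rewrite rowE mulmxA -[delta_mx 0 i]of_rowK.
rewrite -!row_of_boundary boundary_boundary row0.
by apply/rowP=> j; rewrite !mxE ffunE.
Qed.

Lemma boundary_mx_neq0 i j :
  bd i j != 0 -> face j \subset face i /\ card_face i = (card_face j).+1.
Proof.
rewrite mxE => ne0; have [v /andP[vj /eqP vE]] : exists v, (v \notin face j) && (v |: face j == face i).
  apply/existsP; apply: contraNT ne0 => /existsPn no.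
  by rewrite big_pred0 // => v; apply/negbTE/no.
by rewrite /card_face -vE subsetUr cardsU1 vj.
Qed.

Lemma boundary_mx_homogeneous : homogeneous card_face 1 0 bd.
Proof. by move=> i j /boundary_mx_neq0[_ ->]; rewrite addn1 addn0. Qed.

Definition row_chain D j (z : 'rV[K]_N) : Prop :=
  forall i, z 0 i != 0 -> face i \in D /\ card_face i = j.

Lemma row_chainP D j z : row_chain D j z <-> is_chain D j (of_row z).
Proof.
split=> [zD s|zD i]; last by have := zD (face i); rewrite ffunE enum_rank_face.
by rewrite ffunE => /zD; rewrite /card_face face_rank.
Qed.

Lemma acyclic_rowP D : acyclic K D <->
  forall j z, row_chain D j z -> z *m bd = 0 ->
    exists2 c, row_chain D j.+1 c & c *m bd = z.
Proof.
split=> acD j z zD z0.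
  have [||c cD cz] := acD j (of_row z); first exact/row_chainP.
    apply: (can_inj row_ofK); rewrite row_of_boundary of_rowK z0.
    by apply/rowP=> i; rewrite !mxE ffunE.
  exists (row_of c); first by apply/row_chainP; rewrite row_ofK.
  by rewrite -row_of_boundary cz of_rowK.
have [||c cD cz] := acD j (row_of z); first by apply/row_chainP; rewrite row_ofK.
  by rewrite -row_of_boundary z0; apply/rowP=> i; rewrite !mxE ffunE.
exists (of_row c); first exact/row_chainP.
by apply: (can_inj row_ofK); rewrite row_of_boundary of_rowK.
Qed.

Lemma boundary_mx_facet s v : v \in s -> bd (enum_rank s) (enum_rank (s :\ v)) != 0.
Proof.
move=> vs; rewrite mxE !face_rank (big_pred1 v) ?sg_neq0 // => w.
rewrite !inE /=; apply/andP/eqP => [[ws /eqP e]|->]; last by rewrite eqxx setD1K.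
have : w \in s by rewrite -e setU11.
by move: ws; case: (w =P v) => //= _ /negP.
Qed.

Lemma row_boundary_neq0 s : s != set0 ->
  (delta_mx 0 (enum_rank s) : 'rV[K]_N) *m bd != 0.
Proof.
case/set0Pn=> v /boundary_mx_facet; rewrite -rowE; apply: contraNneq.
by move=> /(congr1 (fun u : 'rV_N => u 0 (enum_rank (s :\ v)))); rewrite !mxE => ->.
Qed.

Lemma acyclic_simplex V : V != set0 -> acyclic K (restriction [set: {set 'I_k}] V).
Proof.
case/set0Pn=> a aV j z zV z0; exists (cone a z); last first.
  rewrite boundary_cone z0 (_ : cone a 0 = 0) ?subr0 //.
  by apply/ffunP=> t; rewrite !ffunE mulr0 if_same.
move=> s; rewrite ffunE; case: ifP => [as_|]; last by rewrite eqxx.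
rewrite mulf_eq0 negb_or => /andP[_ /zV]; rewrite !inE /= => -[sV <-].
by rewrite (cardsD1 a s) as_ -(setD1K as_) subUset sub1set aV sV.
Qed.

End BoundaryMatrix.

(** * Joins, Scarf faces and lcm labels *)

Section Lub.
Variables (k : nat) (L : {set {set 'I_k}}).
Implicit Types (S T V : {set 'I_k}).

Lemma sub_lub T : T \subset lub L T.
Proof. by apply/bigcapsP=> V /andP[]. Qed.

Lemma lub_min T V : V \in L -> T \subset V -> lub L T \subset V.
Proof. by move=> VL TV; apply: bigcap_inf; rewrite VL. Qed.

Lemma lub_id V : V \in L -> lub L V = V.
Proof. by move=> VL; apply/eqP; rewrite eqEsubset lub_min // sub_lub. Qed.

Hypothesis hL : atomistic L.

Lemma lub_in T : lub L T \in L.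
Proof.
have [_ LT _ LI] := hL.
by apply: (big_ind (fun V => V \in L)) => // V /andP[].
Qed.

Lemma lub_sub S T : (lub L S \subset lub L T) = (S \subset lub L T).
Proof.
apply/idP/idP; first exact/subset_trans/sub_lub.
exact/lub_min/lub_in.
Qed.

Lemma lubS S T : S \subset T -> lub L S \subset lub L T.
Proof. by move=> ST; rewrite lub_sub (subset_trans ST) ?sub_lub. Qed.

Lemma lub_eq T : (lub L T == T) = (T \in L).
Proof. by apply/eqP/idP => [<-|]; [exact: lub_in | exact: lub_id]. Qed.

(** If s is the join of a single set of atoms, that set is s itself. For t inside s, the union of t
    with the atoms of s outside the join of t also has join s, hence equals s, so the join of t
    cannot exceed t. *)
Lemma scarfP (s : {set 'I_k}) : reflect (forall t : {set 'I_k}, t \subset s -> t \in L) (s \in scarf L).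
Proof.
rewrite inE; apply: (iffP andP) => [[sL /cards1P[u uP]] t ts|sub].
  have lubE T : (lub L T == s) = (T == u).
    by have /setP/(_ T) := uP; rewrite !inE.
  have us : s = u by apply/eqP; rewrite -lubE lub_id.
  have : t :|: (s :\: lub L t) == u.
    rewrite -lubE eqEsubset lub_min ?subUset ?ts ?subsetDl //=.
    apply/subsetP=> x xs; have [xt|xt] := boolP (x \in lub L t).
      exact: (subsetP (lubS (subsetUl _ _)) _ xt).
    by apply: (subsetP (sub_lub _)); rewrite !inE xs xt orbT.
  rewrite -us => /eqP sE; rewrite -lub_eq eqEsubset sub_lub andbT.
  apply/subsetP=> x xt; have xs : x \in s by apply: (subsetP (lub_min sL ts) _ xt).
  by move: xs; rewrite -{1}sE !inE xt /= orbF.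
have sL := sub _ (subxx s); split=> //; apply/cards1P; exists s.
apply/setP=> T; rewrite !inE; apply/eqP/eqP => [e|->]; last exact: lub_id.
by rewrite -e lub_id // sub // -e sub_lub.
Qed.
End Lub.

Section LcmLabel.
Variables (n m : nat) (g : 'I_m -> 'X_{1..n}).

Definition lcm_of (t : {set 'I_m}) : 'X_{1..n} := \big[@mlcm n/0%MM]_(i in t) g i.

Lemma lcm_ofP (t : {set 'I_m}) w : reflect (forall i, i \in t -> (g i <= w)%MM) (lcm_of t <= w)%MM.
Proof.
rewrite /lcm_of (big_morph (fun u => (u <= w)%MM) (id1 := true) (op1 := andb)).
- by rewrite big_andE; apply: forall_inP.
- exact: lem_mlcm.
by apply/mnm_lepP=> i; rewrite mnm0E.
Qed.

Lemma le_lcm_of (t : {set 'I_m}) i : i \in t -> (g i <= lcm_of t)%MM.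
Proof. by move: i; apply/lcm_ofP/lepm_refl. Qed.

Lemma lcm_of0 : lcm_of set0 = 0%MM.
Proof. by rewrite /lcm_of big_set0. Qed.

Lemma lcm_of1 i : lcm_of [set i] = g i.
Proof. by rewrite /lcm_of big_set1E mlcm0. Qed.
End LcmLabel.

(** The lcm lattice of g is identified with L so that the generator [g j] is the atom j; this one
    condition fixes divisibility between all lcms, see [labelled_le]. *)
Definition labelled (n k : nat) (g : 'I_k -> 'X_{1..n}) (L : {set {set 'I_k}}) : Prop :=
  forall j t, (g j <= lcm_of g t)%MM = (j \in lub L t).

Lemma labelled_le n k (g : 'I_k -> 'X_{1..n}) L : atomistic L -> labelled g L ->
  forall s t, (lcm_of g s <= lcm_of g t)%MM = (lub L s \subset lub L t).
Proof.
move=> hL gL s t; rewrite lub_sub //; apply/lcm_ofP/subsetP => le j js.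
  by rewrite -gL le.
by rewrite gL le.
Qed.

Section MonomialIdealTheory.
Variables (K : fieldType) (n m : nat) (g : 'I_m -> 'X_{1..n}).
Local Notation I := (monomial_ideal (K := K) g).

Lemma monomial_ideal0 : I 0.
Proof. by exists (fun=> 0); rewrite big1 // => i _; rewrite mul0r. Qed.

Lemma monomial_idealP a x y : I x -> I y -> I (a * x + y).
Proof.
move=> [c ->] [c' ->]; exists (fun i => a * c i + c' i).
rewrite mulr_sumr -big_split /=; apply: eq_bigr => i _.
by rewrite mulrDl mulrA.
Qed.

Lemma monomial_ideal_sum (J : Type) (r : seq J) F :
  (forall j, I (F j)) -> I (\sum_(j <- r) F j).
Proof.
move=> IF; elim/big_ind: _ => // [|x y Ix Iy]; first exact: monomial_ideal0.
by rewrite -[x]mul1r; apply: monomial_idealP.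
Qed.

Lemma monomial_ideal_gen a i : I (a * 'X_[g i]).
Proof.
exists (fun j => if j == i then a else 0); rewrite (bigD1 i) //= eqxx.
by rewrite big1 ?addr0 // => j /negPf->; rewrite mul0r.
Qed.
End MonomialIdealTheory.

(** * Cellular resolutions *)

Section FaceProjection.
Variables (R : nzRingType) (k : nat) (D : {set {set 'I_k}}).
Local Notation N := #|{: {set 'I_k}}|.

Definition face_proj i : 'M[R]_N :=
  \matrix_(a, b) ([&& a == b, face a \in D & card_face a == i])%:R.

Lemma mul_face_proj m (x : 'M[R]_(m, N)) i r a :
  (x *m face_proj i) r a = if (face a \in D) && (card_face a == i) then x r a else 0.
Proof.
rewrite mxE (bigD1 a) //= big1 ?addr0 => [|b ba].
  by rewrite mxE eqxx; case: ifP; rewrite ?mulr1 ?mulr0.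
by rewrite mxE (negPf ba) mulr0.
Qed.

Lemma face_projP (x : 'rV[R]_N) i : x *m face_proj i = x <->
  forall a, x 0 a != 0 -> face a \in D /\ card_face a = i.
Proof.
split=> [e a|xD].
  by rewrite -e mul_face_proj; case: ifP => [/andP[-> /eqP]|]; rewrite ?eqxx.
apply/rowP=> a; rewrite mul_face_proj; case: ifPn => // Da.
apply/eqP; rewrite eq_sym; apply: contraNT Da => /xD[-> ->].
by rewrite eqxx.
Qed.

Lemma face_projK i : face_proj i *m face_proj i = face_proj i.
Proof.
apply/row_matrixP=> a; rewrite row_mul; apply/face_projP => b.
rewrite !mxE; case: (a =P b) => [<-|_]; rewrite /= ?eqxx //.
by case: andP => [[-> /eqP]|]; rewrite ?eqxx.
Qed.
End FaceProjection.

Section Coordinate.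
Variables (R : nzRingType) (N : nat) (i : 'I_N).
Definition coordinate (x : 'rV[R]_N) : R^o := x 0 i.
Lemma coordinate_linear : linear coordinate.
Proof. by move=> a x y; rewrite /coordinate !mxE. Qed.
HB.instance Definition _ := GRing.isLinear.Build R 'rV[R]_N R^o *:%R coordinate coordinate_linear.
End Coordinate.

Section Cellular.
Variables (K : fieldType) (k n : nat) (g : 'I_k -> 'X_{1..n}).
Variables (L D : {set {set 'I_k}}).
Hypotheses (hL : atomistic L) (gL : labelled g L) (hD : simplicial_complex D).
Hypothesis acD :
  forall V : {set 'I_k}, V \in L -> V != set0 -> acyclic K (restriction D V).
Local Notation N := #|{: {set 'I_k}}|.
Local Notation MP := {mpoly K[n]}.

Definition lub_label (i : 'I_N) : {set 'I_k} := lub L (face i).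
Definition lcm_label (i : 'I_N) : 'X_{1..n} := lcm_of g (face i).
Local Notation homo := (homogenize lcm_label).
Local Notation bd := (boundary_mx K k).
Local Notation Q := (face_proj K D).

Lemma lcm_labelP i j :
  (lcm_label j <= lcm_label i)%MM = (lub_label j \subset lub_label i).
Proof. exact: labelled_le. Qed.

Lemma boundary_mx_monotone : monotone lub_label bd.
Proof. by move=> i j /boundary_mx_neq0[ji _]; apply: lubS. Qed.

Lemma face_proj_monotone i : monotone lub_label (Q i).
Proof. by move=> a b; rewrite mxE; case: (a =P b) => [->|]; rewrite ?eqxx. Qed.

Lemma homogenize_face_proj i : homo (Q i) = face_proj MP D i.
Proof.
apply/matrixP=> a b; rewrite !mxE; case: (a =P b) => [->|_] /=; last by rewrite scale0r.
have -> : (lcm_label b - lcm_label b = 0)%MM by apply/mnmP=> l; rewrite mnmBE mnm0E subnn.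
by rewrite mpolyX0; case: (_ && _); rewrite ?scale1r ?scale0r.
Qed.

Lemma face_proj_boundary i : Q i.+1 *m bd *m Q i = Q i.+1 *m bd.
Proof.
have [_ _ down] := hD.
apply/row_matrixP=> a; rewrite row_mul; apply/face_projP => b.
rewrite mxE => /mulmx_neq0[c [+ /boundary_mx_neq0[bc dc]]].
rewrite mxE; case: (a =P c) => [->|]; rewrite /= ?eqxx //.
case: andP => [[Dc /eqP ic] _|]; rewrite ?eqxx //.
by split; [apply: down Dc | move: ic; rewrite dc => -[]].
Qed.

(** The acyclicity criterion for cellular resolutions: in multidegree w the complex is the chain
    complex of D on the vertices whose generators divide w. This vertex set lies in L, so [acD]
    fills each strand, and the fillings are reassembled. *)
Lemma cellular_exact i (x : 'rV[MP]_N) :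
  x *m homo (Q i.+1) = x -> x *m homo bd = 0 ->
  exists2 y, y *m homo (Q i.+2) = y & y *m homo bd = x.
Proof.
rewrite !homogenize_face_proj => /face_projP xD x0.
pose V w := [set j | (g j <= w)%MM].
have VL w : V w \in L.
  rewrite -lub_eq // eqEsubset sub_lub andbT; apply/subsetP=> j.
  rewrite -gL inE => le; apply: lepm_trans le _.
  by apply/lcm_ofP => l; rewrite inE.
have sV w a : (lcm_label a <= w)%MM = (face a \subset V w).
  by apply/lcm_ofP/subsetP=> le l /le; rewrite inE.
have fill w : exists y, row_chain (restriction D (V w)) i.+2 y /\
    y *m bd = strand lcm_label w x.
  have sx : row_chain (restriction D (V w)) i.+1 (strand lcm_label w x).
    by move=> a /strand_neq0[aw /xD[Da da]]; rewrite inE Da -sV.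
  (* If no generator divides w, only the empty face is left, and its cardinality is not i + 1, so
     the strand is 0. *)
  have [V0|V0] := eqVneq (V w) set0.
    exists 0; split=> [a|]; first by rewrite mxE eqxx.
    rewrite mul0mx; apply/esym/rowP=> a; rewrite [RHS]mxE.
    apply/eqP/negbNE/negP => /sx[]; rewrite V0 inE subset0 => /andP[_ /eqP fa].
    by rewrite /card_face fa cards0.
  have /acyclic_rowP/(_ _ _ sx)[|y yD yx] := acD (VL w) V0; last by exists y.
  rewrite -(strandM lcm_labelP) ?x0 ?strand0 //; exact: boundary_mx_monotone.
pose Y w := sval (cid (fill w)); have [W xW] := strand_decomposition lcm_label x.
have YP w : row_chain (restriction D (V w)) i.+2 (Y w) /\
    Y w *m bd = strand lcm_label w x by exact: svalP (cid (fill w)).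
exists (\sum_(w <- W) unstrand lcm_label w (Y w)).
  rewrite mulmx_suml; apply: eq_bigr => w _.
  apply/face_projP => a; rewrite mxE => Ya.
  have /(YP w).1 : Y w 0 a != 0 by apply: contraNneq Ya => ->; rewrite scale0r.
  by rewrite inE => -[/andP[]].
rewrite [RHS]xW mulmx_suml; apply: eq_bigr => w _.
rewrite -(YP w).2 (unstrandM lcm_labelP) //; first exact: boundary_mx_monotone.
by move=> a /(YP w).1[]; rewrite inE sV => /andP[].
Qed.

Section Truncation.
Variables (p : nat) (E : 'M[K]_N).
Hypotheses (p_gt0 : (0 < p)%N) (mE : monotone lub_label E) (EE : E *m E = E).
Hypotheses (EQ : E *m Q p = E) (EB : E *m bd = Q p *m bd).
Hypothesis BE : Q p.+1 *m bd *m E = 0.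

(** The complex is cut at degree p, where E projects onto a complement of the boundaries: [EB] says
    that only cycles are discarded, [BE] that boundaries are killed. If D has no face with p + 1
    vertices, E may be [Q p] itself. *)
Definition truncation i : 'M[K]_N :=
  if (i < p)%N then Q i else if i == p then E else 0.

Lemma truncation_monotone i : monotone lub_label (truncation i).
Proof.
rewrite /truncation; case: ifP => _; first exact: face_proj_monotone.
by case: ifP => // _ a b; rewrite mxE eqxx.
Qed.

Lemma truncationK i : truncation i *m truncation i = truncation i.
Proof.
by rewrite /truncation; case: ifP => _; [exact: face_projK | case: ifP; rewrite ?mul0mx].
Qed.

Lemma truncation_face_proj i : truncation i *m Q i = truncation i.
Proof.
rewrite /truncation; case: ifP => _; first exact: face_projK.
by case: eqP => [->|]; rewrite ?mul0mx.
Qed.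

Lemma truncation_boundary i : (i <= p)%N -> truncation i *m bd = Q i *m bd.
Proof. by rewrite /truncation leq_eqVlt; case: eqP => [->|_ /= ->] //; rewrite ltnn. Qed.

Lemma truncation_lt i : (i < p)%N -> truncation i = Q i.
Proof. by rewrite /truncation => ->. Qed.

Lemma truncation_last : truncation p = E.
Proof. by rewrite /truncation ltnn eqxx. Qed.

Lemma truncation_gt i : (p < i)%N -> truncation i = 0.
Proof. by move=> pi; rewrite /truncation ltnNge (ltnW pi) gtn_eqF. Qed.

Lemma truncation_boundaryK i :
  truncation i.+1 *m bd *m truncation i = truncation i.+1 *m bd.
Proof.
have [ip|pi] := ltnP i p; last by rewrite truncation_gt ?mul0mx.
by rewrite (truncation_boundary ip) truncation_lt // face_proj_boundary.
Qed.

Local Notation MT i := (homo (truncation i)).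
Local Notation MB := (homo bd).

Definition cell_module i : lmodType MP := retract (MT i).

Fact cell_boundary_subproof i (x : cell_module i.+1) :
  kval x *m MB *m MT i = kval x *m MB.
Proof.
rewrite -(retractP x) -!mulmxA -!(homogenizeM lcm_labelP) ?mulmxA ?truncation_boundaryK //.
all: by do ?apply: monotoneM; do ?[exact: truncation_monotone | exact: boundary_mx_monotone].
Qed.

Definition cell_boundary i : {linear cell_module i.+1 -> cell_module i} :=
  to_retract (g := (mulmxr MB : {linear 'rV[MP]_N -> 'rV[MP]_N}) \o @kval _ _ _ _)
    (@cell_boundary_subproof i).

Lemma cell_boundaryE i x : kval (cell_boundary i x) = kval x *m MB.
Proof. by []. Qed.

Lemma homogeneous_boundary_sqr : MB *m MB = 0.
Proof.
rewrite -(homogenizeM lcm_labelP) ?boundary_mx_sqr ?homogenize0 //; exact: boundary_mx_monotone.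
Qed.

Lemma cell_idempotent i : MT i *m MT i = MT i.
Proof.
rewrite -(homogenizeM lcm_labelP) ?truncationK //; exact: truncation_monotone.
Qed.

Definition to_cell i : {linear 'rV[MP]_N -> cell_module i} :=
  retract_proj (cell_idempotent i).

Lemma to_cellE i (x : 'rV[MP]_N) : kval (to_cell i x) = x *m MT i. Proof. by []. Qed.

Lemma homogenize_face_proj_boundary i :
  homo (Q i.+1) *m MB *m homo (Q i) = homo (Q i.+1) *m MB.
Proof.
have mB := boundary_mx_monotone; have mQ := face_proj_monotone.
have mQB := monotoneM (mQ i.+1) mB.
by rewrite -!(homogenizeM lcm_labelP) ?face_proj_boundary //.
Qed.

Lemma to_cell_boundary i (x : 'rV[MP]_N) : (i <= p)%N ->
  x *m homo (Q i) = x -> kval (to_cell i x) *m MB = x *m MB.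
Proof.
move=> ip xQ; rewrite -{2}xQ -!mulmxA -!(homogenizeM lcm_labelP).
- by rewrite truncation_boundary.
all: by do ?[exact: face_proj_monotone | exact: boundary_mx_monotone | exact: truncation_monotone].
Qed.

Lemma cell_module_proj i (x : cell_module i) : kval x *m homo (Q i) = kval x.
Proof.
rewrite -(retractP x) -mulmxA -(homogenizeM lcm_labelP) ?truncation_face_proj //.
  exact: truncation_monotone.
exact: face_proj_monotone.
Qed.

Lemma cell_module_gt i : (p < i)%N -> forall x : cell_module i, x = 0.
Proof.
move=> pi x; have x0 : kval x = 0; last first.
  by apply: val_inj; rewrite [LHS]x0 [RHS]linear0.
have := retractP x; move: (kval x) => v <-.
by rewrite (truncation_gt pi) homogenize0 mulmx0.
Qed.

Lemma cell_exact i (x : cell_module i.+1) :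
  cell_boundary i x = 0 <-> exists y, cell_boundary i.+1 y = x.
Proof.
split=> [x0|[y <-]]; last first.
  by apply: val_inj; rewrite /= -mulmxA homogeneous_boundary_sqr mulmx0.
have [pi|ip] := ltnP p i.+1.
  rewrite (cell_module_gt pi x).
  exists 0.
  exact: linear0.
have xB : kval x *m MB = 0 by have /(congr1 (@kval _ _ _ _)) := x0.
have [y yQ yx] := cellular_exact (cell_module_proj x) xB.
(* Projecting the filling y to the truncated complex leaves its boundary unchanged. *)
have [ip2|pi2] := leqP i.+2 p.
  by exists (to_cell i.+2 y); apply: val_inj; rewrite [LHS]to_cell_boundary.
(* In the top degree x is fixed by E and is also a boundary, which E kills, so x = 0. *)
have ep : i.+1 = p by apply/eqP; rewrite eqn_leq ip.
have x0' : kval x = 0; last first.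
  by exists 0; rewrite linear0; apply: val_inj; rewrite [RHS]x0' [LHS]linear0.
have := retractP x; move: (kval x) yx => v yx; rewrite ep truncation_last => <-.
rewrite -yx -yQ ep -!mulmxA -!(homogenizeM lcm_labelP) ?mulmxA ?BE ?homogenize0 ?mulmx0 //.
all: do ?[exact: mE | exact: face_proj_monotone | exact: boundary_mx_monotone].
by apply: monotoneM => //; exact: boundary_mx_monotone.
Qed.

Section Augmentation.
Variables (M : lmodType MP) (pi : {linear MP^o -> M}).
Hypotheses (surj_pi : surj pi) (piP : forall x, pi x = 0 <-> monomial_ideal g x).
Local Notation i0 := (enum_rank (set0 : {set 'I_k})).

Definition cell_augment : {linear cell_module 0 -> M} :=
  pi \o (@coordinate MP N i0) \o (@kval _ _ _ _).

Lemma cell_augmentE x : cell_augment x = pi (kval x 0 i0).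
Proof. by []. Qed.

Lemma empty_face : set0 \in D. Proof. by have [] := hD. Qed.

Lemma cell_augment_surj : surj cell_augment.
Proof.
move=> m; have [f fm] := surj_pi m.
exists (to_cell 0 (f *: delta_mx 0 i0)); rewrite cell_augmentE to_cellE truncation_lt // homogenize_face_proj mul_face_proj face_rank empty_face.
by rewrite /card_face face_rank cards0 !mxE !eqxx mulr1.
Qed.

Lemma boundary_mx_vertex i : bd (enum_rank [set i]) i0 = 1.
Proof.
rewrite mxE !face_rank (big_pred1 i) => [|v].
  rewrite /sg (_ : [set _ in _ | _] = set0) ?cards0 //.
  by apply/setP=> x; rewrite !inE.
by rewrite !inE /= setU0 (inj_eq set1_inj).
Qed.

Lemma cell_augment_exact (x : cell_module 0) :
  cell_augment x = 0 <-> exists y, cell_boundary 0 y = x.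
Proof.
have [_ vD _] := hD.
split=> [/piP[c xc]|[y <-]]; last first.
  apply/piP; rewrite -[X in monomial_ideal g X]/((kval y *m MB) 0 i0) mxE.
  apply: monomial_ideal_sum => a.
  rewrite [X in _ * X]mxE; have [->|] := eqVneq (bd a i0) 0.
    by rewrite scale0r mulr0; apply: monomial_ideal0.
  move=> /[dup]/boundary_mx_neq0[_]; rewrite /card_face face_rank cards0.
  move=> /eqP/cards1P[i fa] _.
  rewrite /lcm_label face_rank fa lcm_of0 subm0 lcm_of1 -scalerAr scalerAl.
  exact: monomial_ideal_gen.
have {}xc : kval x 0 i0 = \sum_i c i * 'X_[g i] by [].
  pose y : 'rV[MP]_N := \sum_i c i *: delta_mx 0 (enum_rank [set i]).
  have yQ : y *m homo (Q 1) = y.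
    rewrite mulmx_suml; apply: eq_bigr => i _.
    rewrite -scalemxAl; congr (_ *: _); rewrite homogenize_face_proj.
    apply/face_projP => a; rewrite mxE eqxx /=; case: (a =P _) => [->|]; rewrite ?eqxx //.
    by rewrite /card_face face_rank cards1; split=> //; apply: vD.
  exists (to_cell 1 y); apply: val_inj; rewrite [LHS]to_cell_boundary //.
  have /face_projP x0 : kval x *m face_proj MP D 0 = kval x.
    by rewrite -homogenize_face_proj cell_module_proj.
  apply/rowP=> a; have [->|a0] := eqVneq a i0.
    rewrite [RHS]xc /y mulmx_suml summxE; apply: eq_bigr => i _.
    rewrite -scalemxAl [LHS]mxE -rowE [X in _ * X]mxE [X in _ * X]mxE.
    by rewrite boundary_mx_vertex scale1r /lcm_label !face_rank lcm_of0 subm0 lcm_of1.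
  rewrite [RHS](_ : _ = 0).
    have : y *m MB *m homo (Q 0) = y *m MB.
      by rewrite -yQ -!mulmxA; congr (_ *m _); rewrite mulmxA homogenize_face_proj_boundary.
    rewrite homogenize_face_proj => /face_projP yB.
    apply/eqP/negbNE/negP => /yB[_ /eqP]; rewrite cards_eq0 => /eqP fa.
    by rewrite -fa enum_rank_face eqxx in a0.
  apply/eqP/negbNE/negP => /x0[_ /eqP]; rewrite cards_eq0 => /eqP fa.
  by rewrite -fa enum_rank_face eqxx in a0.
Qed.

Lemma cell_resolution : resolution cell_boundary cell_augment.
Proof.
split; [move=> i | exact: cell_augment_surj | exact: cell_augment_exact | exact: cell_exact].
exact/retract_projective/cell_idempotent.
Qed.
End Augmentation.

Lemma truncated_projres (M : lmodType MP) :
  is_quotient (monomial_ideal (K := K) g) M -> has_projres M p.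
Proof.
move=> [pi [surj_pi piP]]; exists cell_module, cell_boundary, (cell_augment pi).
have [projP surjP ex0 exS] := cell_resolution surj_pi piP; split.
- by move=> i; split; [exact: projP | exact: cell_module_gt].
- exact: surjP.
- exact: ex0.
- exact: exS.
Qed.
End Truncation.
End Cellular.

(** * Projective dimension and exactness of the label part *)

Section ProjectiveDimensionBounds.
Variables (K : fieldType) (k n : nat) (g : 'I_k -> 'X_{1..n}).
Variable L : {set {set 'I_k}}.
Hypotheses (hL : atomistic L) (gL : labelled g L).
Variable M : lmodType {mpoly K[n]}.
Hypothesis hM : is_quotient (monomial_ideal (K := K) g) M.
Local Notation N := #|{: {set 'I_k}}|.
Local Notation MP := {mpoly K[n]}.
Local Notation bd := (boundary_mx K k).
Local Notation full := [set: {set 'I_k}].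
Local Notation Q := (face_proj K full).

Lemma simplicial_full : simplicial_complex full.
Proof. by split=> [|i|s t _ _]; rewrite inE. Qed.

Lemma acyclic_full (V : {set 'I_k}) :
  V \in L -> V != set0 -> acyclic K (restriction full V).
Proof. by move=> _; apply: acyclic_simplex. Qed.

Lemma face_proj_homogeneous a b i j (A : 'M[K]_N) :
  homogeneous (@card_face k) a b A -> (j + a = i + b)%N ->
  Q i *m A *m Q j = Q i *m A.
Proof.
move=> hA ij; apply/row_matrixP=> r; rewrite row_mul; apply/face_projP => c.
rewrite mxE => /mulmx_neq0[l [+ /hA lc]]; rewrite mxE inE.
case: (r =P l) => [->|_]; rewrite /= ?eqxx //.
by case: (card_face l =P i) => [li _|]; rewrite ?eqxx // inE; split=> //; lia.
Qed.

Lemma face_proj_big i : (k < i)%N -> Q i = 0.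
Proof.
move=> ki; apply/matrixP=> a b; rewrite !mxE inE /=.
rewrite [_ == i]ltn_eqF ?andbF //; apply: leq_ltn_trans ki.
by rewrite -[X in (_ <= X)%N]card_ord; apply: max_card.
Qed.

Lemma projres_of_exact_above p : (0 < p)%N ->
  exact_above (@card_face k) (lub_label L) p bd -> has_projres M p.
Proof.
move=> p_gt0 ex; have mB : monotone (lub_label L) bd by exact: boundary_mx_monotone.
have hB := @boundary_mx_homogeneous K k.
have [H [mH hH secH]] := filtered_section mB hB (boundary_mx_sqr K k) ex.
have hHB : homogeneous (@card_face k) 0 0 (H *m bd).
  by move=> i j /(homogeneousM hH hB); lia.
have BHB : Q p.+1 *m bd *m H *m bd = Q p.+1 *m bd.
  apply/row_matrixP=> r; rewrite !row_mul; apply: secH => l.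
  rewrite !mxE inE; case: (r =P l) => [<-|_]; rewrite /= ?eqxx //.
  by case: (card_face r =P _) => [->|]; rewrite /= ?eqxx.
have QHQ : Q p *m H *m Q p.+1 = Q p *m H by apply: (face_proj_homogeneous hH); lia.
have QHBQ : Q p *m (H *m bd) *m Q p = Q p *m (H *m bd).
  exact: (face_proj_homogeneous hHB).
have BQ : Q p.+1 *m bd *m Q p = Q p.+1 *m bd by apply: (face_proj_homogeneous hB); lia.
(* As H is a section of the boundary, H bd projects degree p onto the boundaries; E is the
   complementary projection. *)
pose E := Q p - Q p *m (H *m bd).
have BE : Q p.+1 *m bd *m E = 0.
  by rewrite mulmxBr [X in _ - X]mulmxA BQ mulmxA BHB subrr.
have QE : Q p *m E = E by rewrite mulmxBr mulmxA !face_projK.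
have EE : E *m E = E.
  rewrite {1}/E mulmxBl QE mulmxA -QHQ -!mulmxA (mulmxA (Q p.+1)) BE.
  by rewrite !mulmx0 subr0.
apply: (truncated_projres hL gL simplicial_full acyclic_full p_gt0 (E := E)) => //.
- apply: monotoneD; first exact: face_proj_monotone.
  by apply/monotoneN/monotoneM; [exact: face_proj_monotone | apply: monotoneM].
- by rewrite mulmxBl face_projK QHBQ.
- by rewrite mulmxBl -!mulmxA boundary_mx_sqr !mulmx0 subr0.
Qed.

Local Notation const := (map_mx (mcoeff 0%MM : {rmorphism MP -> K})).

(** A cycle c of the label part, read as a constant chain X, has a boundary without constant terms.
    In the contraction -X = d s' X + s d X the last term then has no constant terms either, so
    constant terms exhibit c as a boundary of the label part. *)
Lemma exact_above_of_projres q :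
  has_projres M q -> exact_above (@card_face k) (lub_label L) q bd.
Proof.
move=> [P [dP [eP [projP surjP exP0 exP]]]].
have [pi [surj_pi piP]] := hM.
apply: exact_above_graded; first exact: boundary_mx_homogeneous.
(* This p exceeds k, so the truncation removes nothing from the Taylor complex, and it exceeds the
   degree m + 1 under study. *)
case=> // m qm c cm c0; pose p := (k + m).+3.
have mE : monotone (lub_label L) (Q p) by exact: face_proj_monotone.
have EE : Q p *m Q p = Q p by exact: face_projK.
have EB : Q p *m bd = Q p *m bd by [].
have BE : Q p.+1 *m bd *m Q p = 0 by rewrite face_proj_big ?mul0mx // /p; lia.
have resT := cell_resolution hL gL simplicial_full acyclic_full (isT : (0 < p)%N)
  mE EE EE EB BE surj_pi piP.
have resP : resolution dP eP by split=> // i; have [] := projP i.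
have P0 i : (q < i)%N -> forall x : P i, x = 0 by have [] := projP i.
have [s [s' hs]] := contract_above_length resP resT P0 qm.
pose tocell i := to_cell full hL gL p mE EE i.
pose C : 'rV[MP]_N := map_mx (@mpolyC n K) c.
have CK : const C = c by apply/rowP=> a; rewrite !mxE /= mcoeffC eqxx mulr1.
have kx : kval (tocell m.+1 C) = C.
  rewrite to_cellE truncation_lt /p; last by lia.
  rewrite homogenize_face_proj; apply/face_projP => a; rewrite mxE => Ca.
  have /cm/eqP : c 0 a != 0 by apply: contraNneq Ca => ->; rewrite mpolyC0.
  by rewrite inE.
have mB : monotone (lub_label L) bd by exact: boundary_mx_monotone.
have constB (v : 'rV[MP]_N) :
    const (v *m homogenize (lcm_label g) bd) = const v *m label_part (lub_label L) bd.
  by rewrite map_mxM (homogenize_label_part (lcm_labelP hL gL)).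
set X := tocell m.+1 C in kx; set dX := cell_boundary hL gL simplicial_full mE EB m X.
have hX : - C = kval (s' X) *m homogenize (lcm_label g) bd + kval (s dX).
  by rewrite -[in LHS]kx; apply: (congr1 (@kval _ _ _ _) (hs X)).
have s0 : const (kval (s dX)) = 0.
  have dX0 : const (kval dX) = 0 by rewrite cell_boundaryE kx constB CK c0.
  exact: (@map_retract_eq0 _ _ (mcoeff 0%MM : {rmorphism MP -> K}) N
    (homogenize (lcm_label g) (truncation full p (Q p) m))
    (homogenize (lcm_label g) (truncation full p (Q p) m.+1)) s dX
    (cell_idempotent full hL gL p mE EE m) dX0).
have := congr1 const hX; rewrite map_mxN map_mxD constB s0 CK addr0 => cE.
by rewrite -[c]opprK cE eqmx_opp submxMl.
Qed.
End ProjectiveDimensionBounds.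

(** * Stoss complexes *)

(** Exactness above p only involves entries of the boundary that leave degrees above p, so only
    there must the two labellings preserve labels along the same entries. *)
Lemma exact_above_relabel (K : fieldType) (N k : nat) (deg : 'I_N -> nat)
    (lab lab' : 'I_N -> {set 'I_k}) p (B : 'M[K]_N) :
  homogeneous deg 1 0 B ->
  (forall i j, (p < deg i)%N -> B i j != 0 -> (lab i == lab j) = (lab' i == lab' j)) ->
  exact_above deg lab p B -> exact_above deg lab' p B.
Proof.
move=> hB eq_lab exB x xp x0.
have eqB i j : (p < deg i)%N -> label_part lab B i j = label_part lab' B i j.
  move=> pi; rewrite !mxE; have [->|Bij] := eqVneq (B i j) 0; first by rewrite !if_same.
  by rewrite (eq_lab i j).
have /submxP[y xy] : (x <= label_part lab B)%MS.
  apply: exB => //; rewrite -x0; apply/rowP=> j; rewrite mxE [RHS]mxE.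
  apply: eq_bigr => i _; have [->|/xp pi] := eqVneq (x 0 i) 0; first by rewrite !mul0r.
  by rewrite eqB.
(* The rest of y has its boundary in degrees at most p, where x vanishes. *)
apply/submxP; exists (\row_i if (p.+1 < deg i)%N then y 0 i else 0).
apply/rowP=> j; have [pj|jp] := ltnP p (deg j).
  rewrite {1}xy mxE [RHS]mxE; apply: eq_bigr => i _; rewrite [in RHS]mxE.
  case: ifPn => [pi|pi]; first by rewrite eqB // ltnW.
  rewrite [label_part _ _ _ _](_ : _ = 0) ?mulr0 ?mul0r //.
  by apply/eqP/negbNE/negP => /label_part_neq0[_ /hB]; lia.
have -> : x 0 j = 0 by apply/eqP/negbNE/negP => /xp; lia.
apply/esym/eqP/negbNE/negP => /mulmx_neq0[i [+ /label_part_neq0[_ /hB ij]]].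
by rewrite mxE; case: ifPn => [|_]; [lia | rewrite eqxx].
Qed.

Section LatticeExactness.
Variables (K : fieldType) (k : nat) (L : {set {set 'I_k}}).
Hypothesis hL : atomistic L.
Local Notation N := #|{: {set 'I_k}}|.
Local Notation bd := (boundary_mx K k).

(** A Scarf face survives in the homology of the label part: its facets carry other labels, so it is
    a cycle, and no larger face has join s, so it is not a boundary. *)
Lemma scarf_bound p (s : {set 'I_k}) :
  exact_above (@card_face k) (lub_label L) p bd -> s \in scarf L -> (#|s| <= p)%N.
Proof.
move=> ex /(scarfP hL) sL; rewrite leqNgt; apply/negP => ps.
have lub_s (t : {set 'I_k}) : t \subset s -> lub L t = t by move=> ts; rewrite lub_id ?sL.
have : ((delta_mx 0 (enum_rank s) : 'rV[K]_N) <= label_part (lub_label L) bd)%MS.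
  apply: ex => [i|].
    rewrite mxE eqxx /=; case: (i =P _) => [->|]; rewrite ?eqxx //.
    by rewrite /card_face face_rank.
  apply/rowP=> j; rewrite -rowE [RHS]mxE mxE.
  apply/eqP/negbNE/negP => /label_part_neq0[+ /boundary_mx_neq0[]].
  rewrite /lub_label /card_face face_rank => + js; rewrite !lub_s // => <-; lia.
case/submxP=> y /(congr1 (fun u : 'rV_N => u 0 (enum_rank s))).
rewrite [LHS]mxE !eqxx /= => /eqP; rewrite eq_sym; apply/negP.
rewrite (_ : (y *m _) 0 _ = 0) ?[0 == 1]eq_sym ?oner_neq0 //.
apply/eqP/negbNE/negP => /mulmx_neq0[l [_ /label_part_neq0[ls /boundary_mx_neq0[sl]]]].
rewrite /card_face face_rank => ds; move: (sub_lub L (face l)).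
rewrite -/(lub_label L l) ls /lub_label face_rank lub_s // => /subset_leq_card.
by lia.
Qed.

(** Adding s changes joins only of sets contained in s. The strict bound on s also spares the
    facets, of cardinality at least p, of the faces in degrees above p. *)
Lemma exact_above_add_face p (s : {set 'I_k}) : (#|s| < p)%N ->
  exact_above (@card_face k) (lub_label L) p bd ->
  exact_above (@card_face k) (lub_label (s |: L)) p bd.
Proof.
move=> sp; apply: exact_above_relabel; first exact: boundary_mx_homogeneous.
have lubE i : (#|s| < card_face i)%N -> lub_label (s |: L) i = lub_label L i.
  move=> si; apply: eq_bigl => V; rewrite !inE; case: (V =P s) => //= ->.
  rewrite (_ : face i \subset s = false) ?andbF //; apply/negbTE.
  by apply: contraTN si => /subset_leq_card; rewrite -leqNgt.
by move=> i j pi /boundary_mx_neq0[_ ij]; rewrite !lubE //; lia.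
Qed.
End LatticeExactness.

Section Stoss.
Variables (K : fieldType) (k d : nat) (Delta : {set {set 'I_k}}).
Hypothesis hDelta : stoss_complex K Delta d.
Local Notation N := #|{: {set 'I_k}}|.
Local Notation bd := (boundary_mx K k).
Local Notation L0 := (acyclic_lattice K Delta).
Local Notation full := [set: {set 'I_k}].
Implicit Types (s t V : {set 'I_k}).

Lemma stoss_complexP : simplicial_complex Delta. Proof. by have [] := hDelta. Qed.

Lemma stoss_card s : s \in Delta -> (#|s| <= d.+1)%N.
Proof. by have [_ [_ +] _ _] := hDelta; apply. Qed.

Lemma stoss_skeleton s : (#|s| <= d)%N -> s \in Delta.
Proof. by have [_ _ + _] := hDelta; apply. Qed.

Lemma stoss_down s t : t \subset s -> s \in Delta -> t \in Delta.
Proof. by have [_ _] := stoss_complexP; apply. Qed.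

Lemma stoss_fill j (z : 'rV[K]_N) : row_chain Delta j z -> z *m bd = 0 ->
  exists2 c, row_chain Delta j.+1 c & c *m bd = z.
Proof. by have [_ _ _ /acyclic_rowP] := hDelta; apply. Qed.

Lemma stoss_gt0 : (0 < k)%N.
Proof.
have [_ [[s _ sd] _] _ _] := hDelta.
by have := subset_leq_card (subsetT s); rewrite cardsT card_ord sd; case: (k).
Qed.

Lemma row_chain_big j (z : 'rV[K]_N) : (d.+1 < j)%N -> row_chain Delta j z -> z = 0.
Proof.
move=> dj zD; apply/rowP=> i; rewrite [RHS]mxE; apply/eqP/negbNE/negP => /zD[].
by move=> /stoss_card; rewrite /card_face; lia.
Qed.

(** A top cycle could only be filled by faces with d + 2 vertices. Consequently fillings of
    (d-1)-cycles in Delta are unique. *)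
Lemma top_cycle_eq0 (z : 'rV[K]_N) : row_chain Delta d.+1 z -> z *m bd = 0 -> z = 0.
Proof.
move=> zD z0; have [c cD <-] := stoss_fill zD z0.
by rewrite (row_chain_big _ cD) ?mul0mx.
Qed.

Lemma row_chain_restriction D V j (z : 'rV[K]_N) :
  row_chain (restriction D V) j z -> row_chain D j z.
Proof. by move=> zV i /zV[]; rewrite inE => /andP[]. Qed.

(** Only degree d matters: below it the simplex on V supplies a filling whose faces have at most d
    vertices and so lie in Delta, and above it cycles vanish. *)
Lemma stoss_restriction_acyclic V : V != set0 ->
  (forall z, row_chain (restriction Delta V) d z -> z *m bd = 0 ->
     exists2 c, row_chain (restriction Delta V) d.+1 c & c *m bd = z) ->
  acyclic K (restriction Delta V).
Proof.
move=> V0 fillV; apply/acyclic_rowP => j z zV z0.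
have zD := row_chain_restriction zV.
have [jd|dj|jd] := ltngtP j d.
- have zF : row_chain (restriction full V) j z.
    by move=> i /zV[]; rewrite !inE => /andP[_ ->].
  have /acyclic_rowP/(_ _ _ zF z0)[c cF cz] := acyclic_simplex (K := K) V0.
  exists c => // i /cF[]; rewrite !inE /= => iV ci; split=> //.
  by rewrite iV andbT; apply: stoss_skeleton; move: ci; rewrite /card_face => ->.
- exists 0; first by move=> i; rewrite mxE eqxx.
  rewrite mul0mx; have [jd|jd] := leqP j d.+1; last by rewrite (row_chain_big jd zD).
  by have e : j = d.+1; [lia | rewrite e in zD; rewrite (top_cycle_eq0 zD z0)].
- by rewrite jd in zV *; apply: fillV.
Qed.

Lemma acyclic_latticeP V : V \in L0 -> V != set0 -> acyclic K (restriction Delta V).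
Proof. by rewrite inE => /orP[->|/asboolP]. Qed.

Lemma face_acyclic_lattice s : s \in Delta -> s \in L0.
Proof.
move=> sD; rewrite inE; have [//|s0] := eqVneq s set0; apply/asboolP.
rewrite (_ : restriction _ _ = restriction full s); first exact: acyclic_simplex.
apply/setP=> t; rewrite !inE; case: (boolP (t \subset s)); rewrite ?andbF ?andbT // => ts.
exact: stoss_down sD.
Qed.

Lemma acyclic_lattice_atomistic : atomistic L0.
Proof.
have [D0 D1 _] := stoss_complexP; split.
- exact: face_acyclic_lattice.
- rewrite inE; apply/orP; right; apply/asboolP.
  rewrite (_ : restriction _ _ = Delta); first by have [] := hDelta.
  by apply/setP=> t; rewrite inE subsetT andbT.
- by move=> i; apply: face_acyclic_lattice.
move=> A B AL BL; rewrite inE; have [//|AB0] := eqVneq (A :&: B) set0.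
have A0 : A != set0 by apply: contraNneq AB0 => ->; rewrite set0I.
have B0 : B != set0 by apply: contraNneq AB0 => ->; rewrite setI0.
apply/asboolP/stoss_restriction_acyclic => // z zAB z0.
have fill V : V \in L0 -> V != set0 -> A :&: B \subset V ->
    exists2 c, row_chain (restriction Delta V) d.+1 c & c *m bd = z.
  move=> VL V0 sV; have /acyclic_rowP := acyclic_latticeP VL V0; apply=> // i /zAB.
  by rewrite !inE => -[/andP[-> /subset_trans->]].
(* Two fillings of z differ by a top-dimensional cycle of Delta, which is 0. *)
have [a aA az] := fill A AL A0 (subsetIl A B).
have [b bB bz] := fill B BL B0 (subsetIr A B).
have /eqP : a - b = 0.
  apply: top_cycle_eq0; last by rewrite mulmxBl az bz subrr.
  move=> i /addmx_neq0[/(row_chain_restriction aA)//|]; rewrite mxE oppr_eq0.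
  exact: row_chain_restriction bB i.
rewrite subr_eq0 => /eqP ab; exists a => // i ai.
have [] := aA i ai; have [] := bB i; rewrite -?ab // !inE subsetI.
by move=> /andP[_ ->] _ /andP[-> ->].
Qed.

(** A minimal nonface s in L(Delta) would have its boundary filled inside s by faces with as many
    vertices as s. The only candidate is s, which is not in Delta, yet the boundary of s is
    nonzero. *)
Lemma scarf_acyclic_lattice : scarf L0 = Delta.
Proof.
apply/setP=> s; apply/(scarfP acyclic_lattice_atomistic)/idP => [|sD t ts]; last first.
  exact/face_acyclic_lattice/(stoss_down ts).
have [m] := ubnP #|s|; elim: m s => // m IH s; rewrite ltnS => sm sL.
have [->|s0] := eqVneq s set0; first by have [] := stoss_complexP.
have subD t : t \proper s -> t \in Delta.
  move=> ts; apply: IH; first by apply: leq_trans sm; apply: proper_card.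
  by move=> u /subset_trans/(_ (proper_sub ts)); apply: sL.
apply/negPn/negP => sD; have acs := acyclic_latticeP (sL s (subxx s)) s0.
pose z : 'rV[K]_N := delta_mx 0 (enum_rank s) *m bd.
have zD : row_chain (restriction Delta s) #|s|.-1 z.
  move=> i; rewrite /z -rowE mxE => /boundary_mx_neq0[].
  rewrite /card_face face_rank inE => si e; split; last by rewrite e.
  by rewrite si andbT; apply: subD; rewrite properEcard si e ltnSn.
have /acyclic_rowP/(_ _ _ zD)[|c cD cz] := acs.
  by rewrite -mulmxA boundary_mx_sqr mulmx0.
have /negP := row_boundary_neq0 K s0; apply; rewrite -[_ *m _]/z -cz.
suff -> : c = 0 by rewrite mul0mx.
apply/rowP=> i; rewrite [RHS]mxE; apply/eqP/negbNE/negP => /cD[].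
rewrite inE prednK ?card_gt0 // => /andP[iD si] ci.
have /eqP e : face i == s by rewrite eqEcard si -ci leqnn.
by rewrite -e iD in sD.
Qed.

(* The projector 1 - H bd kills boundaries and fixes the d-faces of Delta, since
   H cannot enlarge a face that belongs to L. Hence it maps a filling of z in the
   full simplex on V to the filling of z in Delta, and it respects V. *)
Lemma sub_acyclic_lattice (L : {set {set 'I_k}}) : atomistic L -> Delta \subset L ->
  exact_above (@card_face k) (lub_label L) d.+1 bd -> L \subset L0.
Proof.
move=> hL /subsetP DL ex; apply/subsetP=> V VL; rewrite inE.
have [//|V0] := eqVneq V set0; apply/asboolP/stoss_restriction_acyclic => // z zV z0.
have mB : monotone (lub_label L) bd by exact: boundary_mx_monotone.
have hB := @boundary_mx_homogeneous K k.
have [H [mH hH secH]] := filtered_section mB hB (boundary_mx_sqr K k) ex.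
have zF : row_chain (restriction full V) d z.
  by move=> i /zV[]; rewrite !inE => /andP[_ ->].
have /acyclic_rowP/(_ _ _ zF z0)[c cV cz] := acyclic_simplex (K := K) V0.
have [c' cD c'z] := stoss_fill (row_chain_restriction zV) z0.
have c'H : c' *m H = 0.
  apply/rowP=> j; rewrite [RHS]mxE; apply/eqP/negbNE/negP.
  move=> /mulmx_neq0[i [/cD[/DL iL ci] Hij]].
  have := mH _ _ Hij; rewrite /lub_label (lub_id iL).
  move=> /(subset_trans (sub_lub _ _))/subset_leq_card.
  by have := hH _ _ Hij; rewrite /card_face; lia.
have cHsupp : supported (@card_face k) (fun m => d.+1 < m)%N (c *m H).
  by move=> j /mulmx_neq0[i [/cV[_ ci] /hH]]; lia.
have hHB : homogeneous (@card_face k) 0 0 (H *m bd).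
  by move=> i j /(homogeneousM hH hB); lia.
set w := c - c *m (H *m bd).
have wE i : w 0 i != 0 -> card_face i = d.+1.
  move=> /addmx_neq0[/cV[]//|]; rewrite mxE oppr_eq0.
  by move=> /mulmx_neq0[l [/cV[_ cl] /hHB]]; lia.
have wV i : w 0 i != 0 -> face i \subset V.
  move=> /addmx_neq0[/cV[]|]; first by rewrite !inE.
  rewrite mxE oppr_eq0 => /mulmx_neq0[l [/cV[]]]; rewrite !inE /= => lV _.
  move=> /(monotoneM mH mB) il; apply: subset_trans (sub_lub L _) _.
  by apply: subset_trans il _; apply: lub_min.
have wz : w *m bd = z.
  by rewrite mulmxBl cz -!mulmxA boundary_mx_sqr !mulmx0 subr0.
suff c'w : c' = w.
  exists c' => // i c'i; have [iD ci] := cD i c'i; split=> //.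
  by rewrite inE iD wV // -c'w.
(* The difference is a cycle of the full simplex, hence a boundary and fixed by H bd, whereas H bd
   annihilates both [c'] and [w]. *)
apply/eqP; rewrite -subr_eq0; apply/eqP; set x := c' - w.
have xF : row_chain (restriction full setT) d.+1 x.
  move=> i xi; split; first by rewrite !inE subsetT.
  by move: xi => /addmx_neq0[/cD[]//|]; rewrite mxE oppr_eq0; apply: wE.
have x0 : x *m bd = 0 by rewrite mulmxBl c'z wz subrr.
have T0 : [set: 'I_k] != set0.
  by apply: contraNneq V0 => T0; rewrite -subset0 -T0 subsetT.
have /acyclic_rowP/(_ _ _ xF x0)[y yF yx] := acyclic_simplex (K := K) T0.
have ys : supported (@card_face k) (fun m => d.+1 < m)%N y by move=> i /yF[_ ->].
rewrite -[LHS]yx -(secH y ys) yx mulmxBl c'H sub0r mulNmx mulmxBl mulmxBl !mulmxA.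
by rewrite secH // subrr oppr0.
Qed.
End Stoss.

(** Delta has no face with d + 2 vertices, so cutting at d + 1 needs no splitting and E is the full
    projection to that degree. *)
Lemma acyclic_lattice_projres (K : fieldType) (k d n : nat) (Delta : {set {set 'I_k}})
    (hDelta : stoss_complex K Delta d) (g : 'I_k -> 'X_{1..n}) (M : lmodType {mpoly K[n]}) :
  labelled g (acyclic_lattice K Delta) -> is_quotient (monomial_ideal (K := K) g) M ->
  has_projres M d.+1.
Proof.
move=> gL; apply: (truncated_projres (acyclic_lattice_atomistic hDelta) gL
  (stoss_complexP hDelta) (@acyclic_latticeP K k Delta) (ltn0Sn d)
  (E := face_proj K Delta d.+1)) => //; rewrite ?face_projK //.
  exact: face_proj_monotone.
rewrite (_ : face_proj K Delta d.+2 = 0) ?mul0mx //; apply/matrixP=> a b; rewrite !mxE.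
case: (boolP (face a \in Delta)) => [/(stoss_card hDelta) da|_]; rewrite ?andbF //=.
by rewrite [_ == d.+2]ltn_eqF ?andbF.
Qed.

Lemma lepm_eq n (u v : 'X_{1..n}) : (forall w, (u <= w)%MM = (v <= w)%MM) -> u = v.
Proof.
move=> e; apply/mnmP=> i; apply/eqP; rewrite eqn_leq.
have /mnm_lepP-> : (u <= v)%MM by rewrite e lepm_refl.
by have /mnm_lepP-> : (v <= u)%MM by rewrite -e lepm_refl.
Qed.

(** * Monomial generators indexed by the atoms of L *)

Section Normalize.
Variables (K : fieldType) (k n m : nat) (g : 'I_m -> 'X_{1..n}) (L : {set {set 'I_k}}).
Hypotheses (k_gt0 : (0 < k)%N) (hL : atomistic L) (min_g : minimal_generators g).
Variable f : 'X_{1..n} -> {set 'I_k}.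
Hypothesis fL : forall u, lcm_lattice g u -> f u \in L.
Hypothesis f_surj : forall A, A \in L -> exists u, lcm_lattice g u /\ f u = A.
Hypothesis f_le : forall u v, lcm_lattice g u -> lcm_lattice g v ->
  (f u \subset f v) = (u <= v)%MM.

Let lcmL (s : {set 'I_m}) : lcm_lattice g (lcm_of g s). Proof. by exists s. Qed.
Let gL i : lcm_lattice g (g i). Proof. by rewrite -(lcm_of1 g); apply: lcmL. Qed.
Let zeroL : lcm_lattice g 0%MM. Proof. by rewrite -(lcm_of0 g); apply: lcmL. Qed.

Let f0 : f 0%MM = set0.
Proof.
have [L0 _ _ _] := hL; have [u [uL fu]] := f_surj L0.
by apply/eqP; rewrite -subset0 -fu f_le //; apply/mnm_lepP=> i; rewrite mnm0E.
Qed.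

(** By minimality a generator 1 would be the only one, and the lcm lattice would be a point. This is
    the ideal (1), which has the lattice on k = 0 atoms. *)
Lemma generator_neq0 i : g i <> 0%MM.
Proof.
move=> gi; have [_ LT _ _] := hL; have [v [[s ->] fv]] := f_surj LT.
suff v0 : \big[@mlcm n/0%MM]_(j in s) g j = 0%MM.
  have : Ordinal k_gt0 \in set0 by rewrite -f0 -v0 fv inE.
  by rewrite inE.
apply: lepm_eq => w; apply/lcm_ofP/idP => [_|_ j _]; first by apply/mnm_lepP=> l; rewrite mnm0E.
have <- : i = j by apply: min_g; rewrite gi; apply/mnm_lepP=> l; rewrite mnm0E.
by rewrite gi; apply/mnm_lepP=> l; rewrite mnm0E.
Qed.

Lemma below_generator u i : lcm_lattice g u -> (u <= g i)%MM -> f u != set0 -> u = g i.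
Proof.
move=> [s ->] le; have [->|/set0Pn[j js] _] := eqVneq s set0.
  by rewrite big_set0 f0 eqxx.
have e : j = i by apply: min_g; apply: lepm_trans le; apply: le_lcm_of.
apply: lepm_eq => w; apply/idP/idP; apply: lepm_trans => //.
by rewrite -e; apply: le_lcm_of.
Qed.

Lemma generator_atom i : exists a, f (g i) = [set a].
Proof.
have [fi0|/set0Pn[a ai]] := eqVneq (f (g i)) set0.
  case: (@generator_neq0 i); apply: lepm_eq => w; apply/idP/idP => _.
    by apply/mnm_lepP=> l; rewrite mnm0E.
  apply: lepm_trans (_ : 0 <= w)%MM; first by rewrite -f_le // fi0 sub0set.
  by apply/mnm_lepP=> l; rewrite mnm0E.
exists a; have [_ _ L1 _] := hL; have [u [uL fu]] := f_surj (L1 a).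
rewrite -fu (@below_generator u i) //; first by rewrite -f_le // fu sub1set.
by apply/set0Pn; exists a; rewrite fu inE.
Qed.

(** An order isomorphism matches minimal generators with atoms and lcms with joins; b inverts the
    matching a from generators to atoms. *)
Lemma normalized_generators :
  exists b : 'I_k -> 'I_m, bijective b /\ labelled (g \o b) L.
Proof.
pose a i := sval (cid (generator_atom i)).
have aP i : f (g i) = [set a i] by exact: svalP (cid (generator_atom i)).
have a_inj : injective a.
  by move=> i j e; apply: min_g; rewrite -f_le // !aP e.
have a_surj j : exists i, a i = j.
  have [_ _ L1 _] := hL; have [u [uL fu]] := f_surj (L1 j).
  have [s us] := uL; have [s0|/set0Pn[i si]] := eqVneq s set0.
    have : j \in f u by rewrite fu set11.
    by rewrite us s0 big_set0 f0 inE.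
  exists i; apply/set1P; rewrite -sub1set -aP -fu f_le // us.
  exact: le_lcm_of.
pose b j := sval (cid (a_surj j)).
have ab j : a (b j) = j by exact: svalP (cid (a_surj j)).
have ba i : b (a i) = i by apply: a_inj; rewrite ab.
exists b; split; first by exists a.
have flub s : f (lcm_of g s) = lub L (a @: s).
  apply/eqP; rewrite eqEsubset; apply/andP; split; last first.
    apply: lub_min; first exact: fL.
    apply/subsetP=> _ /imsetP[i si ->].
    by rewrite -sub1set -aP f_le //; apply: le_lcm_of.
  have [v [vL fv]] := f_surj (lub_in hL (a @: s)).
  rewrite -fv f_le //; apply/lcm_ofP => i si.
  rewrite -f_le // aP sub1set fv; apply: (subsetP (sub_lub _ _)).
  exact: imset_f.
move=> j t; have -> : lcm_of (g \o b) t = lcm_of g (b @: t).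
  apply: lepm_eq => w; apply/lcm_ofP/lcm_ofP => [le _ /imsetP[i it ->]|le i it]; first exact: le.
  by apply: le; apply: imset_f.
rewrite -[(g \o b) j]/(g (b j)) -(f_le (gL _) (lcmL _)) flub aP ab sub1set -imset_comp (eq_imset (g := id)) ?imset_id //.
Qed.
End Normalize.

Lemma is_pdimQ_labelled (K : fieldType) (k p : nat) (L : {set {set 'I_k}}) :
  (0 < k)%N -> atomistic L -> is_pdimQ K L p ->
  exists (n : nat) (g : 'I_k -> 'X_{1..n}) (M : lmodType {mpoly K[n]}),
    [/\ labelled g L, is_quotient (monomial_ideal (K := K) g) M & is_pdim M p].
Proof.
move=> k0 hL [n [m [g [M [min_g [f [fL f_surj f_le]] [pi [surj_pi piP]] pdM]]]]].
have [b [[a ba ab] gbL]] := normalized_generators k0 hL min_g fL f_surj f_le.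
exists n, (g \o b), M; split=> //; exists pi; split=> // x; apply: (iff_trans (piP x)).
split=> -[c ->].
  exists (c \o b); rewrite (reindex b) //; first by exists a => i _; [apply: ba | apply: ab].
exists (c \o a); rewrite (reindex a) /=; last by exists b => i _; [apply: ab | apply: ba].
by apply: eq_bigr => i _; rewrite ab.
Qed.

Section Existence.
Variables (K : fieldType) (k : nat) (L : {set {set 'I_k}}).
Hypothesis hL : atomistic L.
Local Notation N := #|{: {set 'I_k}}|.

(* The product of the variables x_V over all V in L that are not above the atom
   i; the other variables do not occur. *)
Definition lattice_monomial (i : 'I_k) : 'X_{1..N} :=
  [multinom ((face v \in L) && (i \notin face v) : nat) | v < N].
Local Notation g := lattice_monomial.

Lemma lattice_monomial_labelled : labelled g L.
Proof.
move=> j t; apply/idP/idP => [le|jt].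
  apply/bigcapP => V /andP[VL tV]; apply: contraTT isT => jV.
  (* The product of all variables except x_V: it is divisible by every generator from t, as t lies
     in V, but not by [g j] when j lies outside V. *)
  pose w : 'X_{1..N} := [multinom ((v != enum_rank V) : nat) | v < N].
  have /mnm_lepP/(_ (enum_rank V)) : (g j <= w)%MM.
    apply: lepm_trans le _; apply/lcm_ofP => i it; apply/mnm_lepP=> v; rewrite !mnmE.
    case: eqP => [->|_]; last by case: (_ && _).
    by rewrite face_rank (subsetP tV) ?andbF.
  by rewrite !mnmE face_rank VL jV eqxx.
apply/mnm_lepP=> v; rewrite mnmE; case: andP => // -[vL jv].
have /subsetPn[i it iv] : ~~ (t \subset face v).
  by apply: contraNN jv => tv; apply: (subsetP (lub_min vL tv)).
have /mnm_lepP/(_ v) := le_lcm_of g it; apply: leq_trans.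
by rewrite mnmE vL iv.
Qed.

Lemma exact_above_trivial p (B : 'M[K]_N) : (k <= p)%N ->
  exact_above (@card_face k) (lub_label L) p B.
Proof.
move=> kp x xp _; rewrite (_ : x = 0) ?sub0mx //; apply/rowP=> i; rewrite [RHS]mxE.
apply/eqP/negbNE/negP => /xp; have := subset_leq_card (subsetT (face i)).
by rewrite cardsT card_ord /card_face; lia.
Qed.

Lemma is_pdimQ_exists : exists p, is_pdimQ K L p.
Proof.
have gL := lattice_monomial_labelled; have [L0 LT L1 _] := hL.
have [M hM] := quotient_exists (monomial_ideal0 K g) (@monomial_idealP K _ _ g).
have ex_res : exists p, `[< has_projres M p >].
  (* No face has more than k vertices; the successor keeps the length positive when k = 0. *)
  exists k.+1; apply/asboolP; apply: (projres_of_exact_above hL gL hM) => //.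
  exact/exact_above_trivial/leqnSn.
case: (ex_minnP ex_res) => p /asboolP resp minp.
exists p, N, k, g, M; split=> //.
- by move=> i j; rewrite -[g j]lcm_of1 gL lub_id // inE => /eqP.
- pose f (u : 'X_{1..N}) := [set j | (g j <= u)%MM].
  have fE t : f (lcm_of g t) = lub L t by apply/setP=> j; rewrite inE gL.
  exists f; split.
  + by move=> _ [t ->]; rewrite [f _]fE lub_in.
  + by move=> V VL; exists (lcm_of g V); rewrite fE lub_id //; split=> //; exists V.
  + by move=> _ _ [s ->] [t ->]; rewrite ![f _]fE -(labelled_le hL gL).
by split=> // q /asboolP; apply: minp.
Qed.

(** The bounds below are proved for every p satisfying [is_pdimQ], hence apply to the value chosen
    by [xget]. *)
Lemma pdimQP : is_pdimQ K L (pdimQ K L).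
Proof. by have [p hp] := is_pdimQ_exists; apply: classical_sets.xgetPex; exists p. Qed.
End Existence.

Lemma is_pdimQ_iso (K : fieldType) (k p : nat) (L L' : {set {set 'I_k}}) :
  iso L L' -> is_pdimQ K L p -> is_pdimQ K L' p.
Proof.
move=> [h [hL h_surj h_le]] [n [m [g [M [min_g [f [fL f_surj f_le]] hM pdM]]]]].
exists n, m, g, M; split=> //; exists (h \o f); split.
- by move=> u /fL/hL.
- by move=> B /h_surj[A [/f_surj[u [uL <-]] <-]]; exists u.
- by move=> u v uL vL; rewrite /= h_le ?f_le //; apply: fL.
Qed.

Section Bounds.
Variables (K : fieldType) (k p : nat) (L : {set {set 'I_k}}).
Hypotheses (k_gt0 : (0 < k)%N) (hL : atomistic L) (hp : is_pdimQ K L p).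

Lemma exact_above_pdim :
  exact_above (@card_face k) (lub_label L) p (boundary_mx K k).
Proof.
have [n [g [M [gL hM [resM _]]]]] := is_pdimQ_labelled k_gt0 hL hp.
exact: exact_above_of_projres resM.
Qed.

Lemma pdim_le q : (0 < q)%N ->
  exact_above (@card_face k) (lub_label L) q (boundary_mx K k) -> (p <= q)%N.
Proof.
move=> q0 exq; have [n [g [M [gL hM [_ min]]]]] := is_pdimQ_labelled k_gt0 hL hp.
by apply: min; apply: projres_of_exact_above exq.
Qed.
End Bounds.

Lemma pdim_acyclic_lattice (K : fieldType) (k d p : nat) (Delta : {set {set 'I_k}}) :
  stoss_complex K Delta d -> is_pdimQ K (acyclic_lattice K Delta) p -> (p <= d.+1)%N.
Proof.
move=> hD hp; have hL := acyclic_lattice_atomistic hD.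
have [n [g [M [gL hM [_ min]]]]] := is_pdimQ_labelled (stoss_gt0 hD) hL hp.
exact/min/(acyclic_lattice_projres hD gL hM).
Qed.

(** * Comparing atomistic lattices on the same atoms *)

Lemma surjective_join_map_lub (k : nat) (L L' : {set {set 'I_k}}) :
  atomistic L -> L \subset L' -> surjective_join_map L' L (lub L).
Proof.
move=> hL /subsetP LL'; split=> [A _|B BL|A B AL BL].
- exact: lub_in.
- by exists B; [exact: LL' | exact: lub_id].
(* Joins are preserved because the closure [lub L] is left adjoint to the inclusion of L in L'. *)
have sub_l (T : {set 'I_k}) : T \subset lub L' (A :|: B) -> T \subset lub L (lub L' (A :|: B)).
  by move=> h; apply: subset_trans h (sub_lub _ _).
have sub_r (T : {set 'I_k}) : T \subset A :|: B -> lub L T \subset lub L (lub L' (A :|: B)).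
  by move=> h; rewrite lub_sub // sub_l // (subset_trans h) ?sub_lub.
apply/eqP; rewrite eqEsubset [X in X && _]lub_sub // [X in _ && X]lub_sub //.
rewrite subUset !sub_r ?subsetUl ?subsetUr //= andbT.
apply: lub_min; first exact: (LL' _ (lub_in hL _)).
apply: subset_trans (sub_lub _ _).
by apply: setUSS; apply: sub_lub.
Qed.

(** Each atom of L is the image of an atom of L', since some atom below a preimage is not sent to
    the bottom. Counting turns this choice into a permutation of the atoms. After relabelling L
    contains nothing new: the join in L' of the atoms chosen for V is mapped into V, so no further
    atom lies below it. *)
Lemma surjective_join_map_relabel (k : nat) (L L' : {set {set 'I_k}}) f :
  atomistic L -> atomistic L' -> surjective_join_map L' L f ->
  exists L2, [/\ atomistic L2, iso L' L2 & L \subset L2].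
Proof.
move=> hL hL' [fL f_surj f_join].
have [L0 LT L1 LI] := hL; have [L'0 L'T L'1 L'I] := hL'.
have f_mono A B : A \in L' -> B \in L' -> A \subset B -> f A \subset f B.
  move=> AL BL /setUidPr AB; have := f_join A B AL BL; rewrite AB lub_id // => ->.
  exact: subset_trans (subsetUl _ _) (sub_lub _ _).
have f_lub V : V \in L -> forall T : {set 'I_k},
    (forall i, i \in T -> f [set i] \subset V) -> f (lub L' T) \subset V.
  move=> VL T; have [m] := ubnP #|T|; elim: m T => // m IH T; rewrite ltnS => Tm TV.
  have [->|/set0Pn[i iT]] := eqVneq T set0.
    (* Binary joins alone do not fix the image of the bottom; it lies below the image of any
       preimage of the bottom, by monotonicity. *)
    rewrite lub_id //; have [A AL fA] := f_surj _ L0.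
    have := f_mono _ _ L'0 AL (sub0set _); rewrite fA.
    by move=> h; apply: subset_trans h (sub0set _).
  have -> : lub L' T = lub L' ([set i] :|: lub L' (T :\ i)).
    apply/eqP; rewrite eqEsubset; apply/andP; split.
      by rewrite -{1}(setD1K iT); apply: lubS => //; apply: setUS; apply: sub_lub.
    rewrite lub_sub // subUset sub1set (subsetP (sub_lub _ _)) //=.
    by apply: lubS => //; apply: subsetDl.
  rewrite (f_join _ _ (L'1 i) (lub_in hL' _)); apply: lub_min => //; rewrite subUset TV // IH //.
    by move: Tm; rewrite (cardsD1 i T) iT.
  by move=> j /setD1P[_ /TV].
have f_atom j : exists i, f [set i] = [set j].
  have [A AL fA] := f_surj _ (L1 j).
  have [i /andP[iA fi]] : exists i, (i \in A) && (f [set i] != set0).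
    apply/existsP; apply: contraT => /existsPn no.
    have : f (lub L' A) \subset set0.
      by apply: f_lub => // i iA; have := no i; rewrite iA negbK => /eqP->.
    rewrite lub_id // fA => /subsetP/(_ j); rewrite !inE eqxx.
    by move=> /(_ isT).
  exists i; have := f_mono _ _ (L'1 i) AL; rewrite sub1set fA => /(_ iA).
  by rewrite subset1 (negPf fi) orbF => /eqP.
pose tau j := sval (cid (f_atom j)).
have tauP j : f [set tau j] = [set j] by exact: svalP (cid (f_atom j)).
have tau_inj : injective tau by move=> i j e; apply: set1_inj; rewrite -(tauP i) -(tauP j) e.
have [pi piK tauK] : bijective tau by apply: injF_bij.
have imK (A : {set 'I_k}) : tau @: (pi @: A) = A.
  by rewrite -imset_comp (eq_imset (g := id)) ?imset_id //.
exists [set A : {set 'I_k} | tau @: A \in L']; split.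
- split=> [||i|A B]; rewrite ?inE ?imset0 ?imset_set1 //.
    rewrite (_ : _ @: _ = setT) //; apply/setP=> x; rewrite inE.
    by apply/imsetP; exists (pi x); rewrite ?inE ?tauK.
  move=> AL BL; rewrite imsetI; [exact: L'I | by move=> x y _ _; apply: tau_inj].
- exists (fun A : {set 'I_k} => pi @: A); split=> [A AL|B|A B _ _].
  + by rewrite inE imK.
  + rewrite inE => BL; exists (tau @: B); split=> //.
    by rewrite -imset_comp (eq_imset (g := id)) ?imset_id //.
  apply/idP/idP => [|/imsetS-> //].
  by move=> /(imsetS tau); rewrite !imK.
apply/subsetP=> V VL; rewrite inE -lub_eq //; rewrite eqEsubset sub_lub andbT.
apply/subsetP=> i il; have e : i = tau (pi i) by rewrite tauK.
rewrite e; apply: imset_f; rewrite -sub1set -tauP -e.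
have fV : f (lub L' (tau @: V)) \subset V.
  by apply: f_lub => // _ /imsetP[j jV ->]; rewrite tauP sub1set.
by apply: subset_trans fV; apply: f_mono; rewrite ?lub_in ?sub1set.
Qed.

Lemma exact_above_le (K : fieldType) (N k : nat) (deg : 'I_N -> nat)
    (lab : 'I_N -> {set 'I_k}) p q (B : 'M[K]_N) : (p <= q)%N ->
  exact_above deg lab p B -> exact_above deg lab q B.
Proof. by move=> pq ex x xq; apply: ex => i /xq; apply: leq_ltn_trans. Qed.

Lemma iso_card_le (k : nat) (L L' : {set {set 'I_k}}) : iso L L' -> (#|L| <= #|L'|)%N.
Proof.
move=> [h [hL _ h_le]]; rewrite -(card_in_imset (f := h)) => [|A B AL BL hAB].
  by apply/subset_leq_card/subsetP=> _ /imsetP[A /hL AL ->].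
by apply/eqP; rewrite eqEsubset -(h_le _ _ AL BL) -(h_le _ _ BL AL) hAB subxx.
Qed.

(** An intersection with s is either s or a proper subset of s, which lies in L already. *)
Lemma add_minimal_nonmember_atomistic (k : nat) (L : {set {set 'I_k}}) (s : {set 'I_k}) :
  atomistic L -> (forall t : {set 'I_k}, t \proper s -> t \in L) -> atomistic (s |: L).
Proof.
move=> [L0 LT L1 LI] sL.
have sI A : s :&: A \in s |: L.
  have := subsetIl s A; rewrite subEproper => /orP[/eqP->|/sL sA].
    exact: setU11.
  by rewrite inE sA orbT.
split=> [||i|A B /setU1P[->|AL] /setU1P[->|BL]] //; try by apply/setU1P; right.
  by rewrite setIC.
by apply/setU1P; right; apply: LI.
Qed.

(** * Maximality and uniqueness *)

Section Maximality.
Variables (K : fieldType) (k d : nat) (Delta : {set {set 'I_k}}).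
Hypothesis hDelta : stoss_complex K Delta d.
Local Notation L0 := (acyclic_lattice K Delta).
Implicit Type L : {set {set 'I_k}}.

Lemma sub_acyclic_lattice_of_pdim L p : atomistic L -> Delta \subset L ->
  is_pdimQ K L p -> (p <= d.+1)%N -> L \subset L0.
Proof.
move=> hL DL hp pd; apply: (sub_acyclic_lattice hDelta hL DL).
exact/(exact_above_le pd)/(exact_above_pdim (stoss_gt0 hDelta) hL hp).
Qed.

Lemma acyclic_lattice_maximal : maximal_lattice K L0.
Proof.
have hL0 := acyclic_lattice_atomistic hDelta; split=> // L hL not_iso [f f_map].
have [L2 [hL2 isoL2 L02]] := surjective_join_map_relabel hL0 hL f_map.
rewrite ltnNge; apply/negP => le; apply: not_iso.
suff <- : L2 = L0 by [].
have hp := is_pdimQ_iso isoL2 (pdimQP K hL).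
apply/eqP; rewrite eqEsubset L02 andbT; apply: (sub_acyclic_lattice_of_pdim hL2 _ hp).
  apply: subset_trans L02; apply/subsetP=> s; exact: (face_acyclic_lattice hDelta).
exact: leq_trans le (pdim_acyclic_lattice hDelta (pdimQP K hL0)).
Qed.

(** Otherwise the boundary of a set of d + 2 vertices would be a nonzero d-cycle of Delta. *)
Lemma missing_face : (d.+1 < k)%N -> exists2 s : {set 'I_k}, s \notin Delta & #|s| = d.+1.
Proof.
move=> dk; apply/exists2P; apply: contrapT => no.
have allD (s : {set 'I_k}) : #|s| = d.+1 -> s \in Delta.
  by move=> sd; apply/negPn/negP => sD; apply: no; exists s.
(* [dk] unfolds to d.+2 <= k, so t consists of the first d + 2 vertices. *)
pose t : {set 'I_k} := widen_ord dk @: setT.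
have td : #|t| = d.+2.
  rewrite card_imset ?cardsT ?card_ord // => x y /(congr1 (@nat_of_ord k)) xy.
  exact: val_inj.
have t0 : t != set0 by rewrite -card_gt0 td.
have /negP := row_boundary_neq0 K t0; apply; apply/eqP.
apply: (top_cycle_eq0 hDelta); last by rewrite -mulmxA boundary_mx_sqr mulmx0.
move=> i; rewrite -rowE mxE => /boundary_mx_neq0[_].
by rewrite /card_face face_rank td => -[e]; split=> //; apply: allD.
Qed.

Lemma maximal_lattice_unique L :
  maximal_lattice K L -> scarf L = Delta -> L = L0.
Proof.
move=> [hL maxL] scL; have k0 := stoss_gt0 hDelta.
have hL0 := acyclic_lattice_atomistic hDelta.
have faceP := scarfP hL; rewrite scL in faceP.
have DL : Delta \subset L by apply/subsetP=> s /faceP/(_ s (subxx s)).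
have hp := pdimQP K hL; have exL := exact_above_pdim k0 hL hp.
have [pd|dp] := leqP (pdimQ K L) d.+1.
  have sub := sub_acyclic_lattice_of_pdim hL DL hp pd.
  apply/eqP; rewrite eqEcard sub leqNgt; apply/negP => lt.
  (* A strict inclusion would make the dimension grow strictly from L to L(Delta), although it is at
     least d + 1 for L, by a d-face of Delta, and at most d + 1 for L(Delta). *)
  have : (pdimQ K L < pdimQ K L0)%N.
    apply: maxL => //; first by move=> /iso_card_le; rewrite leqNgt lt.
    by exists (lub L); apply: surjective_join_map_lub.
  have := pdim_acyclic_lattice hDelta (pdimQP K hL0).
  have [_ [[s sD sd] _] _ _] := hDelta.
  have : (#|s| <= pdimQ K L)%N by apply: (scarf_bound hL exL); rewrite scL.
  by rewrite sd; lia.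
(* If k <= d + 1, no face has more than d + 1 vertices and the dimension cannot exceed d + 1. *)
have [dk|kd] := ltnP d.+1 k; last first.
  move: dp; rewrite ltnNge (pdim_le k0 hL hp (ltn0Sn d)) //.
  exact: exact_above_trivial.
have [s sD sd] := missing_face dk.
have sub (t : {set 'I_k}) : t \proper s -> t \in L.
  move=> /proper_card; rewrite sd ltnS => td.
  exact/(subsetP DL)/(stoss_skeleton hDelta).
(* All proper subsets of s lie in the complete skeleton, so s in L would be a Scarf face, hence a
   face of Delta. *)
have sL : s \notin L.
  apply: contraNN sD => sL; apply/faceP => t.
  by rewrite subEproper => /orP[/eqP->|/sub].
have hL' := add_minimal_nonmember_atomistic hL sub.
have : (pdimQ K L < pdimQ K (s |: L))%N.
  apply: maxL => //; first by move=> /iso_card_le; rewrite cardsU1 sL ltnn.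
  by exists (lub L); apply: surjective_join_map_lub => //; apply: subsetUr.
rewrite ltnNge (pdim_le k0 hL' (pdimQP K hL')) //; first by lia.
by apply: exact_above_add_face => //; rewrite sd.
Qed.
End Maximality.

Theorem theorem4p5 (K : fieldType) (k d : nat) (Delta : {set {set 'I_k}})
    (hDelta : stoss_complex K Delta d) :
  (maximal_lattice K (acyclic_lattice K Delta) /\
   scarf (acyclic_lattice K Delta) = Delta) /\
  (forall L : {set {set 'I_k}},
     maximal_lattice K L -> scarf L = Delta -> L = acyclic_lattice K Delta).
Proof.
split; last exact: maximal_lattice_unique hDelta.
split; first exact: acyclic_lattice_maximal hDelta.
exact: scarf_acyclic_lattice hDelta.
Qed.
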